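(* There is an effectively computable constant $c$ with $0.176488<c$ such that for every $\epsilon>0$, the minimum number $C(n)$ of vertex-disjoint paths required to cover the divisor graph of $\{1,\ldots,n\}$ satisfies \[C(n) = cn\left(1+O\left(\exp\left(-\sqrt{\left(\tfrac{1}{6}-\epsilon\right)\log n \log \log n}\right)\right)\right).\]
   Context: The divisor graph of a set $S$ of positive integers has vertex set $S$, with two distinct elements joined by an edge if one divides the other. $C(n)$ is the smallest number of pairwise vertex-disjoint paths in the divisor graph of $\{1,\ldots,n\}$ whose union contains every vertex (a single vertex counts as a path). *)

(* Defs.v *)
From mathcomp Require Import all_boot all_order all_algebra.
From mathcomp Require Import all_classical all_reals all_analysis.

Set Implicit Arguments.
Unset Strict Implicit.
Unset Printing Implicit Defensive.

Import Order.TTheory GRing.Theory Num.Theory.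

Local Open Scope nat_scope.

(* Divisor graphs.  A vertex set is a duplicate-free sequence of positive
   integers, a path is the sequence of the vertices it visits. *)

Definition divisor_adj : rel nat :=
  fun a b => (a != b) && ((a %| b) || (b %| a)).

Definition divisor_path (S p : seq nat) : bool :=
  [&& p != [::], uniq p, all (mem S) p & sorted divisor_adj p].

Definition vertex_disjoint (p q : seq nat) : bool := ~~ has (mem p) q.

Definition path_cover (S : seq nat) (P : seq (seq nat)) : bool :=
  [&& all (divisor_path S) P, pairwise vertex_disjoint P
    & all (fun x => has (fun p => x \in p) P) S].

Definition coverable (S : seq nat) (k : nat) : Prop :=
  exists P : seq (seq nat), path_cover S P /\ size P = k.

Lemma coverable_undup (S : seq nat) : coverable S (size (undup S)).
Proof.
exists [seq [:: x] | x <- undup S]; split; last by rewrite size_map.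
apply/and3P; split.
- apply/allP => p /mapP[x]; rewrite mem_undup => xS ->.
  by rewrite /divisor_path /= xS.
- rewrite pairwise_map; have := undup_uniq S; rewrite uniq_pairwise.
  by apply: sub_pairwise => x y /= xy; rewrite /vertex_disjoint /= inE orbF eq_sym.
- apply/allP => x xS; apply/hasP; exists [:: x]; last by rewrite inE.
  by apply/mapP; exists x; rewrite ?mem_undup.
Qed.

Lemma coverable_ex (S : seq nat) : exists k, `[< coverable S k >].
Proof. by exists (size (undup S)); apply/asboolP; exact: coverable_undup. Qed.

Definition path_cover_number (S : seq nat) : nat := ex_minn (coverable_ex S).

Definition C (n : nat) : nat := path_cover_number (iota 1 n).

(* Codes for the partial (mu-)recursive functions of n variables. *)
Inductive recfun : nat -> Type :=
| RZero n : recfun n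
| RSucc : recfun 1
| RProj n (i : 'I_n) : recfun n
| RComp m n (f : recfun m) (g : 'I_m -> recfun n) : recfun n
| RPrec n (f : recfun n) (g : recfun n.+2) : recfun n.+1
| RMu n (f : recfun n.+1) : recfun n.

(* [computes f v y]: the function coded by [f] is defined at [v], with value
   [y].  Recursion and minimization act on the first variable; [g] in
   [RPrec f g] receives the predecessor, the previous value and the
   parameters, in this order. *)
Fixpoint computes n (c : recfun n) : n.-tuple nat -> nat -> Prop :=
  match c in recfun n return n.-tuple nat -> nat -> Prop with
  | RZero n => fun _ y => y = 0
  | RSucc => fun v y => y = (thead v).+1
  | RProj n i => fun v y => y = tnth v i
  | RComp m n f g => fun v y => exists w : m.-tuple nat,
      (forall i, computes (g i) v (tnth w i)) /\ computes f w y
  | RPrec n f g => fun v y =>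
      let u : n.-tuple nat := [tuple of behead v] in
      (fix rec (k : nat) (y : nat) : Prop :=
         if k is k'.+1
         then exists z, rec k' z /\ computes g [tuple of k' :: z :: u] y
         else computes f u y) (thead v) y
  | RMu n f => fun v y =>
      computes f [tuple of y :: v] 0 /\
      forall z, z < y -> exists t, computes f [tuple of z :: v] t.+1
  end.

Definition recursive (h : nat -> nat) : Prop :=
  exists c : recfun 1, forall k, computes c [tuple k] (h k).

(* A real is computable if it is the limit of a computable sequence of
   rationals with error at most 2^-k at the k-th term. *)
Definition computable_real (R : realType) (x : R) : Prop :=
  exists s a b : nat -> nat,
    [/\ recursive s, recursive a, recursive b, (forall k, b k != 0)
      & forall k, (`|x - (-1) ^+ s k * ((a k)%:R / (b k)%:R)| <= 2 ^- k)%R].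

(* Main.v *)
From HB Require Import structures.
From Stdlib Require Import PArith NArith FMapPositive.
Require Import Defs.
From mathcomp Require Import all_boot all_order all_algebra.
From mathcomp Require Import all_classical all_reals all_analysis.
From mathcomp Require Import zify ring lra.
Set Implicit Arguments.
Unset Strict Implicit.
Unset Printing Implicit Defensive.
Import Order.TTheory GRing.Theory Num.Theory numFieldNormedType.Exports.

(** Fix [T] and discard the at most [n / T] numbers below [n / T].  An edge between
    the remaining numbers has a ratio below [T], hence preserves the [T]-rough part,
    so the remaining graph splits into scaled copies [a * V_k], with [a] rough,
    [k = n / a] and [V_k] the set of the [T]-smooth numbers of [(k / T, k]].  As the
    path cover number of [V_k] moves by at most 2 when [k] grows to a smooth [k + 1],
    and not at all otherwise, Rankin's trick with exponent [s] bounds all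
    the error terms by [n^(1 - s)] times Euler products over the primes up to [T].
    Hence [C n / n] is a Cauchy sequence with an explicit rate; the choice
    [L = sqrt (ln n * ln (ln n))], [T ~ exp (L / 2)], [s = ln (ln n) / (2 * L)] makes the
    error [exp (- 9/20 * L)], which beats [exp (- sqrt (1/6) * L)].

    The limit is computable because its rate is explicit and [C] is recursive (a cover
    is coded by a permutation of [1 .. n] written in base [n + 1]).

    For the lower bound take [T = 16].  Deleting [d] vertices raises the number
    of paths by at most [d], and a graph needs as many paths as it has components.
    Deleting the numbers up to [k / 3] gives the density 1/6; better deletion sets
    for [36 <= k < 1089], found by computer and checked by evaluation, increase it to
    0.17649. *)

(** * Path covers and permutations *)

Section Runs.
Variables (T : eqType) (e : rel T).
Implicit Types (x y : T) (s : seq T).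

Fixpoint breaks x s : nat :=
  if s is y :: s' then ~~ e x y + breaks y s' else 0.

(** Cutting [s] at its non-edges leaves [runs s] paths, so that path covers can be traded for
    permutations of the vertex set. *)
Definition runs s : nat := if s is x :: s' then (breaks x s').+1 else 0.

Lemma breaks_le_runs x s : breaks x s <= runs s.
Proof. by case: s => //= y s; rewrite -add1n leq_add2r leq_b1. Qed.

Lemma breaks_cat x s1 s2 : breaks x (s1 ++ s2) <= breaks x s1 + runs s2.
Proof.
elim: s1 x => [|y s1 IH] x /=; last by rewrite -addnA leq_add2l IH.
by case: s2 => //= y s2; case: (e x y); rewrite ?add0n ?add1n.
Qed.

Lemma runs_cat s1 s2 : runs (s1 ++ s2) <= runs s1 + runs s2.
Proof. by case: s1 => // x s1; rewrite /= addSn ltnS breaks_cat. Qed.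

Lemma runs_cons x s : runs (x :: s) <= (runs s).+1.
Proof. by rewrite -add1n -[x :: s]/([:: x] ++ s) (runs_cat [:: x] s). Qed.

Lemma breaks_rem x y s1 s2 : breaks y (s1 ++ s2) <= (breaks y (s1 ++ x :: s2)).+1.
Proof.
elim: s1 y => [|z s1 IH] y /=; last by rewrite -addnS leq_add2l IH.
by case: s2 => //= z s2; case: (e y z) (e x z) (e y x) => [] [] [] /=; lia.
Qed.

(** Deleting [x] replaces its two adjacencies by a single one, which costs at most one more run. *)
Lemma runs_rem x s1 s2 : runs (s1 ++ s2) <= (runs (s1 ++ x :: s2)).+1.
Proof.
case: s1 => [|y s1] /=; last by rewrite ltnS breaks_rem.
by case: s2 => //= y s2; lia.
Qed.

(** No edge joins the two classes, so every change of class along [s] is a break. *)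
Lemma runs_filter (P : pred T) s :
  {in s &, forall x y, e x y -> P x = P y} ->
  runs [seq x <- s | P x] + runs [seq x <- s | ~~ P x] <= runs s.
Proof.
(* The class of the last entry [x] has an open run and is counted by [breaks]; the other class can
   only resume after a break and is counted afresh by [runs]. *)
suff gen x s' : {in x :: s' &, forall x y, e x y -> P x = P y} ->
   (if P x then breaks x [seq x <- s' | P x] + runs [seq x <- s' | ~~ P x]
    else breaks x [seq x <- s' | ~~ P x] + runs [seq x <- s' | P x]) <= breaks x s'.
  case: s => // x s /gen /=; case: (P x) => /= H; first by rewrite addSn ltnS.
  by rewrite addnS ltnS addnC.
elim: s' x => [|y s' IH] x H //=; first by case: (P x).
have Hy : {in y :: s' &, forall x y, e x y -> P x = P y}.
  by move=> a b ya yb; apply: H; rewrite inE ?ya ?yb orbT.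
have := IH y Hy; have := H x y; rewrite !inE !eqxx !orbT /= => /(_ isT isT).
case: (P x); case: (P y) => /=; case: (e x y) => //= Hxy; try by have := Hxy isT.
- by have := breaks_le_runs x [seq z <- s' | P z]; lia.
- by have := breaks_le_runs x [seq z <- s' | ~~ P z]; lia.
Qed.

(** The label is constant along each run. *)
Lemma size_undup_map_runs (U : eqType) (L : T -> U) s :
  {in s &, forall x y, e x y -> L x = L y} -> size (undup (map L s)) <= runs s.
Proof.
case: s => // x s; elim: s x => [|y s IH] x H //.
have Hy : {in y :: s &, forall x y, e x y -> L x = L y}.
  by move=> a b ya yb; apply: H; rewrite inE ?ya ?yb orbT.
have := IH y Hy; have := H x y; rewrite !inE !eqxx !orbT /= => /(_ isT isT).
case: (e x y) => /= [/(_ isT) ->|_]; first by rewrite inE eqxx.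
rewrite add1n /=.
set u := if L y \in _ then _ else _; case: ifP => _ /=; first exact: leqW.
by rewrite ltnS.
Qed.

Lemma runs_flatten (P : seq (seq T)) : all (sorted e) P -> runs (flatten P) <= size P.
Proof.
elim: P => //= p P IH /andP[sp /IH HP]; apply: (leq_trans (runs_cat _ _)).
rewrite -add1n; apply: leq_add => //.
by case: p sp => //= x p; elim: p x => //= y p IHp x /andP[-> /IHp].
Qed.

Lemma runs_split s : exists P : seq (seq T),
  [/\ flatten P = s, all (sorted e) P, [::] \notin P & size P = runs s].
Proof.
case: s => [|x s]; first by exists [::].
suff: exists p (P : seq (seq T)), [/\ (x :: p) ++ flatten P = x :: s,
    path e x p, all (sorted e) P, [::] \notin P & size P = breaks x s].
  by case=> p [P [H1 H2 H3 H4 H5]]; exists ((x :: p) :: P); rewrite /= H2 H5.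
elim: s x => [|y s IH] x; first by exists [::], [::].
have [p [P [[H1] H2 H3 H4 H5]]] := IH y.
case exy: (e x y).
  by exists (y :: p), P; rewrite /= exy /= H1 H2 H5.
by exists [::], ((y :: p) :: P); rewrite /= exy /= H1 H2 H5.
Qed.

End Runs.

Lemma eq_runs_map (T U : eqType) (e : rel T) (e' : rel U) (f : T -> U) s :
  {mono f : x y / e x y >-> e' x y} -> runs e' (map f s) = runs e s.
Proof.
move=> ef; case: s => //= x s; congr _.+1.
by elim: s x => //= y s IH x; rewrite ef IH.
Qed.

(** * Path cover numbers as minima of [runs] over permutations *)

Notation pc := path_cover_number.
Notation druns := (runs divisor_adj).

Lemma pc_min S k : coverable S k -> pc S <= k.
Proof.
rewrite /pc; case: ex_minnP => m _ Hm Hk; apply: Hm; exact/asboolP.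
Qed.

Lemma pc_coverable S : coverable S (pc S).
Proof. by rewrite /pc; case: ex_minnP => m /asboolP. Qed.

Lemma pc_le_runs S s : uniq S -> perm_eq s S -> pc S <= druns s.
Proof.
move=> uS sS; have [P [fP aP nP sP]] := runs_split divisor_adj s.
have us : uniq s by rewrite (perm_uniq sS).
apply: pc_min; exists P; split => //; apply/and3P; split.
- apply/allP => p pP; apply/and4P; split.
  + by apply: contraNneq nP => <-.
  + move: us; rewrite -fP; elim: (P) pP => //= q Q IH.
    rewrite inE cat_uniq => /orP[/eqP <- /andP[] //|/IH H /and3P[_ _ /H]//].
  + apply/allP => x xp; rewrite /= -(perm_mem sS) -fP.
    by apply/flattenP; exists p.
  + by move/allP: aP => /(_ _ pP).
- move: us; rewrite -fP; elim: (P) => //= q Q IH; rewrite cat_uniq => /and3P[_ qQ /IH ->].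
  rewrite andbT; apply/allP => p pQ; rewrite /vertex_disjoint.
  apply: contraNN qQ => /hasP[x xp xq]; apply/hasP; exists x => //.
  by apply/flattenP; exists p.
- apply/allP => x; rewrite -(perm_mem sS) -fP => /flattenP[p pP xp].
  by apply/hasP; exists p.
Qed.

(** The concatenation of an optimal cover breaks at most at the junctions of its paths; [pc_le_runs]
    turns the resulting inequality into an equality. *)
Lemma pc_runs_ex S : uniq S -> exists2 s, perm_eq s S & druns s = pc S.
Proof.
move=> uS; have [P [/and3P[aP pP cP] sP]] := pc_coverable S.
suff pfS : perm_eq (flatten P) S.
  exists (flatten P) => //; apply/eqP; rewrite eqn_leq pc_le_runs // andbT -sP.
  by apply: runs_flatten; apply: sub_all aP => p /and4P[].
apply: uniq_perm => //.
- elim: P aP pP {cP sP} => //= p P IH /andP[/and4P[_ up _ _] aP] /andP[dp pP].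
  rewrite cat_uniq up (IH aP pP) andbT /=; apply/hasPn => x /flattenP[q qP xq].
  by move/allP: dp => /(_ _ qP) /hasPn /(_ _ xq).
- move=> x; apply/flattenP/idP => [[p pP' xp]|xS].
    by move/allP: aP => /(_ _ pP') /and4P[_ _ /allP /(_ _ xp)].
  by move/allP: cP => /(_ _ xS) /hasP[p pP' xp]; exists p.
Qed.

Lemma perm_pc S S' : uniq S -> perm_eq S S' -> pc S = pc S'.
Proof.
suff le S1 S2 : uniq S1 -> perm_eq S1 S2 -> pc S1 <= pc S2.
  move=> uS SS'; apply/eqP; rewrite eqn_leq !le // ?(perm_sym S') //.
  by rewrite -(perm_uniq SS').
move=> uS SS'; have [|s sS' <-] := @pc_runs_ex S2; first by rewrite -(perm_uniq SS').
by apply: pc_le_runs => //; rewrite perm_sym (permPl SS') perm_sym.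
Qed.

Lemma pc_nil : pc [::] = 0.
Proof. by apply/eqP; rewrite -leqn0; apply: (@pc_le_runs [::] [::]). Qed.

Lemma pc_cons x S : uniq (x :: S) -> pc (x :: S) <= (pc S).+1.
Proof.
move=> uS; have [|s sS <-] := @pc_runs_ex S; first by case/andP: uS.
apply: leq_trans (runs_cons _ x s); apply: pc_le_runs => //.
by rewrite perm_cons.
Qed.

(** A deleted vertex splits its path into at most two. *)
Lemma pc_behead x S : uniq (x :: S) -> pc S <= (pc (x :: S)).+1.
Proof.
move=> uS; have [s sS <-] := pc_runs_ex uS.
have xs : x \in s by rewrite (perm_mem sS) inE eqxx.
case/splitPr: xs sS => s1 s2 sS; apply: leq_trans (runs_rem _ x s1 s2).
apply: pc_le_runs; first by case/andP: uS.
by rewrite -(perm_cons x) -(permPr sS) -cat1s perm_catCA.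
Qed.

Lemma pc_cat S1 S2 : uniq (S1 ++ S2) -> pc (S1 ++ S2) <= pc S1 + size S2.
Proof.
elim/last_ind: S2 => [|S2 x IH]; first by rewrite cats0 addn0.
rewrite -rcons_cat rcons_uniq size_rcons addnS => /andP[xS uS].
rewrite (@perm_pc _ (x :: S1 ++ S2)) ?perm_rcons ?rcons_uniq ?xS //.
by apply: leq_trans (pc_cons _) _; rewrite /= ?xS // ltnS IH.
Qed.

Lemma pc_cat_ge S1 S2 : uniq (S1 ++ S2) -> pc S1 <= pc (S1 ++ S2) + size S2.
Proof.
elim/last_ind: S2 => [|S2 x IH]; first by rewrite cats0 addn0.
rewrite -rcons_cat rcons_uniq size_rcons addnS => /andP[xS uS].
rewrite (@perm_pc (rcons _ _) (x :: S1 ++ S2)) ?perm_rcons ?rcons_uniq ?xS //.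
apply: leq_trans (IH uS) _; rewrite -addSn leq_add2r.
by apply: pc_behead; rewrite /= xS.
Qed.

(** Orderings of the two parts concatenate, and conversely [runs_filter] separates an ordering of
    [S]. *)
Lemma pc_filterC (P : pred nat) S : uniq S ->
  {in S &, forall x y, divisor_adj x y -> P x = P y} ->
  pc S = pc [seq x <- S | P x] + pc [seq x <- S | ~~ P x].
Proof.
move=> uS HP; apply/eqP; rewrite eqn_leq; apply/andP; split.
  have [|s1 sS1 <-] := @pc_runs_ex [seq x <- S | P x]; first exact: filter_uniq.
  have [|s2 sS2 <-] := @pc_runs_ex [seq x <- S | ~~ P x]; first exact: filter_uniq.
  apply: leq_trans (runs_cat _ _ _); apply: pc_le_runs => //.
  by rewrite (perm_trans (perm_cat sS1 sS2)) // perm_filterC.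
have [s sS <-] := pc_runs_ex uS.
apply: leq_trans (runs_filter (P := P) _) => [|x y xs ys].
  by apply: leq_add; apply: pc_le_runs; rewrite ?filter_uniq ?perm_filter.
by apply: HP; rewrite -(perm_mem sS).
Qed.

Lemma pc_map (f : nat -> nat) S : uniq S -> injective f ->
  {mono f : x y / divisor_adj x y} -> pc (map f S) = pc S.
Proof.
move=> uS fi fe; have uf : uniq (map f S) by rewrite map_inj_uniq.
apply/eqP; rewrite eqn_leq; apply/andP; split.
  have [s sS <-] := pc_runs_ex uS; rewrite -(eq_runs_map s fe).
  by apply: pc_le_runs => //; exact: perm_map.
have [s sS <-] := pc_runs_ex uf.
have [t ts] : exists t, s = map f t.
  have : {subset s <= map f S} by move=> x; rewrite (perm_mem sS).
  elim: s {sS} => [|x s IH] H; first by exists [::].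
  have [t ->] : exists t, s = map f t by apply: IH => y ys; apply: H; rewrite inE ys orbT.
  have /mapP[y _ ->] : x \in map f S by apply: H; rewrite inE eqxx.
  by exists (y :: t).
rewrite ts (eq_runs_map t fe); apply: pc_le_runs => //.
by apply: perm_map_inj fi _ _ _; rewrite -ts.
Qed.

Lemma pc_labels (L : nat -> nat) S : uniq S ->
  {in S &, forall x y, divisor_adj x y -> L x = L y} ->
  size (undup (map L S)) <= pc S.
Proof.
move=> uS HL; have [s sS <-] := pc_runs_ex uS.
apply: leq_trans (size_undup_map_runs (L := L) _) => [|x y xs ys].
  by rewrite (perm_size (perm_undup (perm_mem (perm_map L sS)))).
by apply: HL; rewrite -(perm_mem sS).
Qed.

(** * Splitting a window by rough parts *)

(** Passage through the intersection: deleting a vertex of [S'] or adding one of [S] costs at most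
    one path. *)
Lemma pc_diff S S' : uniq S -> uniq S' ->
  pc S <= pc S' + (count (fun x => x \notin S') S + count (fun x => x \notin S) S').
Proof.
move=> uS uS'; pose M := [seq x <- S | x \in S'].
pose M' := [seq x <- S' | x \in S].
have MM' : perm_eq M M'.
  by apply: uniq_perm; rewrite ?filter_uniq // => x; rewrite !mem_filter andbC.
have pS : perm_eq (M ++ [seq x <- S | x \notin S']) S by rewrite perm_filterC.
have pS' : perm_eq (M' ++ [seq x <- S' | x \notin S]) S' by rewrite perm_filterC.
rewrite -(perm_pc _ pS) ?(perm_uniq pS) //.
apply: leq_trans (pc_cat _) _; first by rewrite (perm_uniq pS).
have H : pc M <= pc S' + count (fun x => x \notin S) S'.
  rewrite (perm_pc _ MM') ?filter_uniq // -(perm_pc _ pS') ?(perm_uniq pS') //.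
  by rewrite -[count _ S']size_filter; apply: pc_cat_ge; rewrite (perm_uniq pS').
by rewrite size_filter [X in _ <= _ + X]addnC addnA leq_add2r.
Qed.

Lemma pc_classes (f : nat -> nat) S N : uniq S ->
  {in S &, forall x y, divisor_adj x y -> f x = f y} ->
  {in S, forall x, f x < N} ->
  pc S = \sum_(a < N) pc [seq x <- S | f x == a].
Proof.
move=> uS fS fN.
suff H M : pc S = \sum_(a < M) pc [seq x <- S | f x == a] + pc [seq x <- S | M <= f x].
  rewrite (H N) [X in _ + pc X](_ : _ = [::]) ?pc_nil ?addn0 //.
  apply/eqP; rewrite -[_ == _]negbK -has_filter; apply/hasPn => x xS.
  by rewrite -ltnNge fN.
elim: M => [|M ->]; first by rewrite big_ord0 filter_predT.
rewrite big_ord_recr /= -addnA; congr (_ + _).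
rewrite (@pc_filterC (fun x => f x == M)) ?filter_uniq //; last first.
  move=> x y; rewrite !mem_filter => /andP[_ xS] /andP[_ yS] /(fS _ _ xS yS).
  by move=> ->.
rewrite -!filter_predI; congr (pc _ + pc _); apply: eq_filter => x /=; lia.
Qed.

(** Read as a set of primes: [(upto T).-nat] expresses smoothness and [(upto T)^'.-nat]
    roughness. *)
Definition upto (T : nat) : nat_pred := [pred p : nat | p <= T].

Lemma in_upto T p : (p \in upto T) = (p <= T). Proof. by []. Qed.

(** The smooth numbers of the interval from [k / c] (excluded) to [k]. The ratio [c] is separate
    from [T] because the lower bound compares ratios 2, 3 and 16. *)
Definition smooth_window T c k :=
  [seq b <- iota 1 k | (upto T).-nat b && (k < c * b)].

Definition window_pc T k := pc (smooth_window T T k).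

Lemma smooth_window_uniq T c k : uniq (smooth_window T c k).
Proof. by rewrite filter_uniq ?iota_uniq. Qed.

Lemma upto_nat_leq T m : 0 < m <= T -> (upto T).-nat m.
Proof.
case/andP=> m0 mT; apply/pnatP => // p _ /(dvdn_leq m0) pm.
by rewrite in_upto (leq_trans pm).
Qed.

(** The quotient is below [T], so it is smooth and does not affect the rough part. *)
Lemma dvd_partn_upto T n u v : 0 < u -> 0 < v <= n -> n < T * u -> u %| v ->
  u`_(upto T)^' = v`_(upto T)^'.
Proof.
move=> u0 /andP[v0 vn] nT /dvdnP[r vE].
have r0 : 0 < r by move: v0; rewrite vE muln_gt0 => /andP[].
have rT : r < T by move: nT; move: vn; rewrite vE; nia.
rewrite vE partnM // [r`_ _]part_p'nat ?mul1n //.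
by rewrite pnatNK upto_nat_leq // r0 ltnW.
Qed.

(** A member of the class is [a * b] with [b] smooth, and [n < c * (a * b)] amounts to
    [n %/ a < c * b]. *)
Lemma window_class T c n a : 0 < a -> (upto T)^'.-nat a ->
  perm_eq [seq m <- [seq m <- iota 1 n | n < c * m] | m`_(upto T)^' == a]
          [seq a * b | b <- smooth_window T c (n %/ a)].
Proof.
move=> a0 ap; have inj : injective (muln a).
  by move=> x y /eqP; rewrite eqn_pmul2l // => /eqP.
apply: uniq_perm; first by rewrite !filter_uniq ?iota_uniq.
  by rewrite map_inj_uniq ?smooth_window_uniq.
move=> m; rewrite !mem_filter mem_iota add1n ltnS; apply/idP/mapP.
  case/andP=> /eqP ma /and3P[nm m0 mn]; exists m`_(upto T).
    have mE : m`_(upto T) * a = m by rewrite -ma partnC.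
    rewrite mem_filter part_pnat mem_iota add1n ltnS part_gt0 /=.
    by rewrite ltn_divLR // -mulnA mE nm leq_divRL // mE.
  by rewrite -ma mulnC partnC.
case=> b; rewrite mem_filter mem_iota add1n ltnS => /andP[/andP[bs nb] /andP[b0 bn]] ->.
rewrite muln_gt0 a0 b0 /= [a * b]mulnC -leq_divRL // bn andbT.
rewrite mulnA -ltn_divLR // nb andbT partnM // [a`_ _]part_pnat_id //.
by rewrite part_p'nat ?mul1n // pnatNK.
Qed.

Lemma window_class_nil T c n a : ~~ (upto T)^'.-nat a ->
  [seq m <- [seq m <- iota 1 n | n < c * m] | m`_(upto T)^' == a] = [::].
Proof.
move=> ap; rewrite -[RHS](filter_pred0 [seq m <- iota 1 n | n < c * m]).
apply: eq_filter => x /=; apply/negP => /eqP xa.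
by move/negP: ap; apply; rewrite -xa part_pnat.
Qed.

Lemma pc_window_split T n :
  pc [seq m <- iota 1 n | n < T * m] =
  \sum_(1 <= a < n.+1 | (upto T)^'.-nat a) window_pc T (n %/ a).
Proof.
pose S := [seq m <- iota 1 n | n < T * m].
have uS : uniq S by rewrite filter_uniq ?iota_uniq.
have inS m : (m \in S) = [&& n < T * m, 0 < m & m <= n].
  by rewrite mem_filter mem_iota add1n ltnS.
rewrite (@pc_classes (fun m => m`_(upto T)^') S n.+1) //; last 2 first.
- move=> u v; rewrite !inS => /and3P[nu u0 un] /and3P[nv v0 vn] /andP[_].
  case/orP => [uv|vu]; first by rewrite (@dvd_partn_upto T n u v) // v0.
  by rewrite (@dvd_partn_upto T n v u) // u0.
- move=> m; rewrite inS => /and3P[_ m0 mn]; rewrite ltnS (leq_trans _ mn) //.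
  by rewrite dvdn_leq ?dvdn_part.
rewrite -(big_mkord predT (fun a => pc [seq x <- S | x`_(upto T)^' == a])).
(* Zero is not rough, so the class [a = 0] is empty. *)
rewrite big_ltn // [X in X + _](_ : _ = 0) ?add0n; last first.
  by rewrite window_class_nil ?pc_nil.
rewrite [RHS]big_mkcond; apply: eq_big_nat => a /andP[a0 an].
case: ifPn => [ap|ap]; last by rewrite window_class_nil ?pc_nil.
rewrite (perm_pc _ (window_class T n a0 ap)) ?filter_uniq //.
rewrite pc_map ?smooth_window_uniq // => x y.
  by move=> /eqP; rewrite eqn_pmul2l // => /eqP.
  by rewrite /divisor_adj eqn_pmul2l // !dvdn_pmul2l.
exact: iota_uniq.
Qed.

(** The windows, rescaled by the rough numbers [a], partition the numbers above [n / c]. *)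
Lemma size_window_split T c n : 0 < c ->
  \sum_(1 <= a < n.+1 | (upto T)^'.-nat a) size (smooth_window T c (n %/ a)) =
  n - n %/ c.
Proof.
move=> c0; pose S := [seq m <- iota 1 n | n < c * m].
have inS m : (m \in S) = [&& n < c * m, 0 < m & m <= n].
  by rewrite mem_filter mem_iota add1n ltnS.
transitivity (size S).
  transitivity (\sum_(1 <= a < n.+1) size [seq m <- S | m`_(upto T)^' == a]).
    rewrite big_mkcond; apply: eq_big_nat => a /andP[a0 _]; case: ifPn => ap.
      by rewrite (perm_size (window_class c n a0 ap)) size_map.
    by rewrite window_class_nil.
  under eq_bigr do rewrite size_filter -sum1_count big_mkcond.
  rewrite exchange_big /= -sum1_size !big_seq; apply: eq_bigr => m.
  rewrite inS => /and3P[_ m0 mn]; rewrite -big_mkcond /=.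
  under eq_bigl do rewrite eq_sym.
  rewrite big_nat1_eq part_gt0 ltnS (leq_trans _ mn) //.
  by rewrite dvdn_leq ?dvdn_part.
rewrite size_filter; have := count_predC (fun m => n < c * m) (iota 1 n); rewrite size_iota => E.
suff : count (predC (fun m => n < c * m)) (iota 1 n) = n %/ c by lia.
rewrite -size_filter -(size_iota 1 (n %/ c)); apply: perm_size.
apply: uniq_perm; rewrite ?filter_uniq ?iota_uniq // => m.
rewrite mem_filter !mem_iota !add1n !ltnS /= -leqNgt leq_divRL // mulnC.
case: (posnP m) => //= m0; case: (leqP (m * c) n) => //= h.
by apply: leq_trans h; rewrite leq_pmulr.
Qed.

Lemma C_window T n : 0 < T ->
  C n <= pc [seq m <- iota 1 n | n < T * m] + n %/ T /\
  pc [seq m <- iota 1 n | n < T * m] <= C n + n %/ T.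
Proof.
move=> T0; pose S := [seq m <- iota 1 n | n < T * m].
have uS : uniq S by rewrite filter_uniq ?iota_uniq.
have H1 : count (fun x => x \notin S) (iota 1 n) <= n %/ T.
  rewrite -size_filter -(size_iota 1 (n %/ T)); apply: uniq_leq_size.
    by rewrite filter_uniq ?iota_uniq.
  move=> m; rewrite !mem_filter !mem_iota !add1n !ltnS => /andP[H /andP[m0 mn]].
  by move: H; rewrite m0 mn /= andbT -leqNgt leq_divRL // mulnC.
have H2 : count (fun x => x \notin iota 1 n) S = 0.
  apply/eqP; rewrite -leqn0 leqNgt -has_count; apply/hasPn => x.
  by rewrite mem_filter negbK => /andP[].
have := pc_diff (iota_uniq 1 n) uS; have := pc_diff uS (iota_uniq 1 n).
rewrite -[pc (iota _ _)]/(C n) H2 addn0 add0n => A B.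
by split; [apply: leq_trans B _ | apply: leq_trans A _]; rewrite leq_add2l.
Qed.

Lemma window_pc0 T : window_pc T 0 = 0. Proof. exact: pc_nil. Qed.

(** Only [k.+1] can enter, and only an [x] with [T * x = k.+1] can leave. As [T] is itself smooth,
    either event makes [k.+1] smooth. *)
Lemma window_pc_step T k : 1 < T ->
  if (upto T).-nat k.+1 then
    window_pc T k.+1 <= window_pc T k + 2 /\ window_pc T k <= window_pc T k.+1 + 2
  else window_pc T k.+1 = window_pc T k.
Proof.
move=> T1.
have u1 := smooth_window_uniq T T k; have u2 := smooth_window_uniq T T k.+1.
have TT : (upto T).-nat T by rewrite upto_nat_leq // leqnn andbT ltnW.
have new x : x \in smooth_window T T k.+1 -> x \notin smooth_window T T k ->
    x = k.+1 /\ (upto T).-nat k.+1.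
  rewrite !mem_filter !mem_iota !add1n !ltnS => /andP[/andP[xs kx] /andP[x0 xk]].
  rewrite xs x0 (ltnW kx) /= -ltnNge => kx'.
  have <- : x = k.+1 by apply/eqP; rewrite eqn_leq xk.
  by [].
have old x : x \in smooth_window T T k -> x \notin smooth_window T T k.+1 ->
    T * x = k.+1 /\ (upto T).-nat k.+1.
  rewrite !mem_filter !mem_iota !add1n !ltnS => /andP[/andP[xs kx] /andP[x0 xk]].
  rewrite xs x0 (leqW xk) /= andbT -leqNgt => kx'.
  have <- : T * x = k.+1 by apply/eqP; rewrite eqn_leq kx'.
  by rewrite pnatM TT xs.
have c1 : count (fun x => x \notin smooth_window T T k) (smooth_window T T k.+1)
  <= (upto T).-nat k.+1.
  rewrite -size_filter; set s := [seq _ <- _ | _].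
  have us : uniq s by exact: filter_uniq.
  have : {subset s <= if (upto T).-nat k.+1 then [:: k.+1] else [::]}.
    by move=> x; rewrite mem_filter => /andP[xn xo]; have [-> ->] := new x xo xn; rewrite inE.
  by move=> /(uniq_leq_size us); case: ifP.
have c2 : count (fun x => x \notin smooth_window T T k.+1) (smooth_window T T k)
  <= (upto T).-nat k.+1.
  rewrite -size_filter; set s := [seq _ <- _ | _].
  have us : uniq s by exact: filter_uniq.
  have : {subset s <= if (upto T).-nat k.+1 then [:: k.+1 %/ T] else [::]}.
    move=> x; rewrite mem_filter => /andP[xn xo]; have [e E] := old x xo xn.
    by rewrite E inE -e mulKn // ltnW.
  by move=> /(uniq_leq_size us); case: ifP.
have := pc_diff u2 u1; have := pc_diff u1 u2; rewrite -/(window_pc T k) -/(window_pc T k.+1).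
by case: ifP c1 c2 => _ /=; lia.
Qed.

(** * Certified gains in smooth windows *)

(** Started at [2 * v] with fuel 14, the walk visits [2 * v] to [15 * v]: all proper multiples of
    [v] up to [k] when [k < 16 * v]. *)
Fixpoint all_multiples (f : positive -> bool) (fuel : nat) (k v u : positive) : bool :=
  if fuel is n.+1 then
    if Pos.ltb k u then true else f u && all_multiples f n k v (Pos.add u v)
  else true.

Fixpoint uf_root (fuel : nat) (P : PositiveMap.t positive) (v : positive) : positive :=
  if fuel is n.+1 then
    if PositiveMap.find v P is Some u then uf_root n P u else v
  else v.

Fixpoint link_multiples (kept : positive -> bool) (fuel : nat) (k v u : positive)
    (P : PositiveMap.t positive) : PositiveMap.t positive :=
  if fuel is n.+1 then
    if Pos.ltb k u then P else
    link_multiples kept n k v (Pos.add u v)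
      (if kept u then
         let a := uf_root 100 P v in let b := uf_root 100 P u in
         if Pos.eqb a b then P else PositiveMap.add b a P
       else P)
  else P.

(* A union-find forest of the kept vertices.  Only the final check in [gain] matters
   for soundness. *)
Definition components (k : positive) (kept : positive -> bool) (vs : seq positive) :=
  foldr (fun v P => if kept v then link_multiples kept 14 k v (Pos.add v v) P else P)
    (PositiveMap.empty positive) vs.

Definition undeleted (D : PositiveMap.t unit) (v : positive) := ~~ PositiveMap.mem v D.

(** The number of roots minus the number of deletions bounds the path cover number from below; the
    value is the excess over the same bound for the deletion of the numbers up to [k / 3]. A failed
    check returns 0, which is always valid. *)
Definition gain (k : positive) (D : PositiveMap.t unit) (vs : seq positive) : nat :=
  let P := components k (undeleted D) vs in
  let L := uf_root 100 P in
  if all (fun v => undeleted D v ==> all_multiples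
       (fun u => undeleted D u ==> Pos.eqb (L v) (L u)) 14 k v (Pos.add v v)) vs
  then count (fun v => undeleted D v && Pos.eqb (L v) v) vs + size vs
       - (count (fun v => ~~ undeleted D v) vs + count (fun v => Pos.ltb k (3 * v)) vs
          + count (fun v => Pos.ltb k (2 * v)) vs)
  else 0.

Definition toggle (D : PositiveMap.t unit) (v : positive) : PositiveMap.t unit :=
  if PositiveMap.mem v D then PositiveMap.remove v D else PositiveMap.add v tt D.

Definition window_pos (sm : seq positive) (k : positive) : seq positive :=
  [seq v <- sm | Pos.leb v k && Pos.ltb k (16 * v)].

(** A non-smooth [k] leaves the window unchanged, so the previous gain is repeated. The deletion set
    [D] is carried along and toggled at the listed lengths. *)
Fixpoint gains (sm : seq positive) (ks : seq nat) (tg : seq (positive * seq positive))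
    (D : PositiveMap.t unit) (last : nat) : seq nat :=
  if ks is k :: ks' then
    if (upto 16).-nat k then
      let p := Pos.of_nat k in
      let: (D', tg') := if tg is (q, l) :: tg' then
          if Pos.eqb p q then (foldl toggle D l, tg') else (D, tg) else (D, tg) in
      let c := gain p D' (window_pos sm p) in
      c :: gains sm ks' tg' D' c
    else last :: gains sm ks' tg D last
  else [::].

(* [deletions] lists the changes of the set of deleted 13-smooth numbers as the
   length [k] of the window [(k / 16, k]] grows; it was found by simulated annealing. *)
Definition deletions : seq (positive * seq positive) :=
  ([:: (36, [:: 3; 4; 5; 7; 8; 9; 11; 30]); (39, [:: 13]); (42, [:: 42]); (48, [::
   16]); (54, [:: 9; 10; 30]); (60, [:: 20]); (63, [:: 8; 16; 20; 42]); (66,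
   [:: 66]); (75, [:: 10]); (78, [:: 78]); (99, [:: 66]); (104, [:: 8; 9; 14;
   84]); (105, [:: 21]); (110, [:: 22]); (112, [:: 10; 15; 16; 20]); (117, [::
   39; 78]); (120, [:: 40]); (125, [:: 25]); (126, [:: 126]); (130, [:: 26]);
   (132, [:: 12; 24; 44; 90]); (135, [:: 27]); (140, [:: 28; 84]); (144, [::
   24; 40; 120]); (147, [:: 49]); (150, [:: 12; 14; 15; 16; 20; 21; 28; 44; 49;
   90; 120; 126; 132]); (156, [:: 156]); (162, [:: 27]); (165, [:: 33; 55]);
   (175, [:: 14; 15; 21; 35]); (195, [:: 65]); (196, [:: 20; 28; 150]); (198,
   [:: 132]); (208, [:: 16; 198]); (210, [:: 20; 21; 28]); (220, [:: 14; 15;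
   16; 22; 26; 33; 55; 65; 150; 156; 198]); (234, [:: 39]); (242, [:: 16; 20;
   21; 22; 26; 28; 33; 39; 44; 198; 210; 234]); (245, [:: 49]); (260, [:: 52]);
   (264, [:: 264]); (273, [:: 91]); (275, [:: 55]); (294, [:: 294]); (297, [::
   99; 198]); (312, [:: 312]); (315, [:: 20; 21; 25; 28; 33; 35; 39; 44; 49;
   52; 55; 99; 210; 234; 264; 294; 312]); (325, [:: 21; 25; 28; 33; 35; 39; 44;
   49; 52; 55; 65; 294; 312]); (330, [:: 330]); (351, [:: 27; 117; 264]); (363,
   [:: 121]); (385, [:: 77]); (390, [:: 390]); (396, [:: 264]); (416, [:: 27;
   117; 312]); (429, [:: 143]); (441, [:: 294]); (462, [:: 462]); (495, [::
   330]); (507, [:: 169]); (520, [:: 36; 40; 88; 99; 104; 330]); (525, [:: 45;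
   117]); (528, [:: 528]); (546, [:: 546]); (550, [:: 35; 36; 40; 45; 52; 55;
   88; 91; 104; 330; 528; 546]); (572, [:: 52; 91; 546]); (576, [:: 104]);
   (585, [:: 40; 45; 55; 88; 330; 528; 550]); (594, [:: 594]); (624, [:: 40;
   45; 88; 99; 104; 330; 390; 528; 594]); (693, [:: 462]); (702, [:: 117]);
   (726, [:: 726]); (810, [:: 98; 110; 125; 130; 546; 550]); (825, [:: 110]);
   (858, [:: 858]); (975, [:: 130]); (1014, [:: 1014]); (1029, [:: 98]); (1089,
   [:: 726])])%positive.

Definition smooth_pos (N : nat) : seq positive :=
  [seq Pos.of_nat b | b <- iota 1 N & (upto 16).-nat b].

Definition gain_list : seq nat :=
  gains (smooth_pos 1089) (iota 36 1053) deletions (PositiveMap.empty unit) 0.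

(** An integer lower estimate of [scale] times the sum of [c / (j * (j + 1))], each term being
    rounded down. *)
Fixpoint gain_sum (scale j : N) (l : seq nat) : N :=
  if l is c :: l' then
    N.add (N.div (N.mul (N.of_nat c) scale) (N.mul j (N.succ j))) (gain_sum scale (N.succ j) l')
  else 0%num.

(** The target [41 / 800] is chosen so that [1/6 + 192/1001 * 41/800], about 0.176497, exceeds
    0.176488; [192/1001] is the density of the 16-rough numbers. *)
Lemma gain_sum_ge (scale := 1000000000000%num) :
  N.leb (N.mul 41 scale) (N.mul 800 (gain_sum scale 36 gain_list)).
Proof. by vm_compute. Qed.

(* A path meeting [d] deleted vertices meets at most [d + 1] classes of labels. *)
Lemma pc_ge_labels (V : seq nat) (kept : pred nat) (L : nat -> nat) : uniq V ->
  {in V &, forall x y, kept x -> kept y -> x %| y -> L x = L y} ->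
  count (fun v => kept v && (L v == v)) V <= pc V + count (predC kept) V.
Proof.
move=> uV HL; pose K := [seq x <- V | kept x].
have uK : uniq K by exact: filter_uniq.
have KL : {in K &, forall x y, divisor_adj x y -> L x = L y}.
  move=> x y; rewrite !mem_filter => /andP[kx xV] /andP[ky yV] /andP[_].
  by case/orP => h; [|apply/esym]; apply: HL.
have := pc_labels uK KL; have := pc_diff uK uV.
have -> : count (fun x => x \notin V) K = 0.
  apply/eqP; rewrite -leqn0 leqNgt -has_count; apply/hasPn => x.
  by rewrite mem_filter negbK => /andP[].
have -> : count (fun x => x \notin K) V = count (predC kept) V.
  by apply: eq_in_count => x xV; rewrite mem_filter xV andbT.
rewrite add0n => A B; apply: leq_trans A; apply: leq_trans B.
rewrite -size_filter; apply: uniq_leq_size; first exact: filter_uniq.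
move=> x; rewrite mem_filter mem_undup => /andP[/andP[kx /eqP Lx] xV].
by apply/mapP; exists x; rewrite ?mem_filter ?kx.
Qed.

Lemma size_smooth_window T c k : c <= T ->
  size (smooth_window T c k) = count (fun x => k < c * x) (smooth_window T T k).
Proof.
move=> cT; rewrite -size_filter -filter_predI; congr size.
apply: eq_filter => x /=; case: (_.-nat x) => //=; last by rewrite andbF.
by case: ltnP => //= h; rewrite (leq_trans h) // leq_mul2r cT orbT.
Qed.

(** The baseline, written without subtraction, is the number of elements above [k / 2] minus the
    number of elements up to [k / 3]. *)
Definition excess_ge T k c :=
  c + size (smooth_window T 3 k) + size (smooth_window T 2 k)
    <= window_pc T k + size (smooth_window T T k).

(** Once the numbers up to [k / 3] are deleted, all ratios are below 3, so the remaining edges join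
    some [v] to [2 * v]. *)
Lemma excess_ge0 T k : 2 < T -> excess_ge T k 0.
Proof.
move=> T2; rewrite /excess_ge add0n (size_smooth_window _ T2) (size_smooth_window _ (ltnW T2)).
set V := smooth_window T T k; rewrite addnC.
(* Each component is labelled by its largest element, so every number above [k / 2] is its own
   label. *)
pose L v := if k < 2 * v then v else 2 * v.
have uV : uniq V by exact: smooth_window_uniq.
have inV x : x \in V -> 0 < x <= k.
  by rewrite mem_filter mem_iota add1n ltnS => /andP[].
have /(pc_ge_labels uV) : {in V &, forall x y, k < 3 * x -> k < 3 * y -> x %| y -> L x = L y}.
  move=> x y /inV xk /inV yk kx ky /dvdnP[r yE]; rewrite /L yE.
  have : r = 1 \/ r = 2 by move: xk yk kx; rewrite yE; nia.
  case=> rE; rewrite rE ?mul1n // in yE *.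
  by case: ltnP => h; [lia | case: ltnP => //; lia].
have -> : count (predC (fun v => k < 3 * v)) V = size V - count (fun v => k < 3 * v) V.
  by rewrite -(count_predC (fun v => k < 3 * v) V) addKn.
have := count_size (fun v => k < 3 * v) V.
rewrite -/(window_pc T k) => c3; have : count (fun x => k < 2 * x) V <=
    count (fun v => (k < 3 * v) && (L v == v)) V.
  by apply: sub_count => v /= h; rewrite /L h eqxx andbT; lia.
rewrite /window_pc -/V; lia.
Qed.

(** A change could come only from [k.+1] or from a smooth [b] with [c * b = k.+1], and [c <= T]
    makes that product smooth. *)
Lemma smooth_window_step T c k : 0 < c <= T -> ~~ (upto T).-nat k.+1 ->
  smooth_window T c k.+1 = smooth_window T c k.
Proof.
move=> cT nk; rewrite /smooth_window -[k.+1]addn1 iotaD filter_cat /= add1n addn1.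
rewrite (negbTE nk) /= cats0; apply: eq_filter => b; case bs : (_.-nat b) => //=.
apply/idP/idP => [|h]; first exact: ltnW.
rewrite ltn_neqAle h andbT; apply: contraNneq nk => ->.
by rewrite pnatM bs andbT upto_nat_leq.
Qed.

Lemma excess_ge_step T k c : 2 < T -> ~~ (upto T).-nat k.+1 ->
  excess_ge T k c -> excess_ge T k.+1 c.
Proof.
move=> T2 nk; rewrite /excess_ge /window_pc !smooth_window_step ?leqnn ?(ltnW T2) //; lia.
Qed.

Lemma pos_eqP : Equality.axiom Pos.eqb.
Proof. by move=> x y; apply: (iffP idP) => /Pos.eqb_eq. Qed.
HB.instance Definition _ := hasDecEq.Build positive pos_eqP.

Lemma all_multiplesP f n k v u : all_multiples f n k v u ->
  forall w, (exists2 i, i < n & Pos.to_nat w = Pos.to_nat u + i * Pos.to_nat v) ->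
  Pos.to_nat w <= Pos.to_nat k -> f w.
Proof.
elim: n u => [|n IH] u /=; first by move=> _ w [].
case: Pos.ltb_spec => [ku _ w [i _ wE] wk|_ /andP[fu /IH H] w [[|i] iN wE] wk].
- by have := Pos2Nat.inj_lt k u; case=> /(_ ku) + _; lia.
- by rewrite (_ : w = u) //; apply: Pos2Nat.inj; rewrite wE mul0n addn0.
- by apply: H wk; exists i => //; rewrite Pos2Nat.inj_add wE; lia.
Qed.

(** The check in [gain] makes the roots constant along divisibility between undeleted vertices, as
    [pc_ge_labels] demands. *)
Lemma gain_sound k D vs : uniq vs ->
  map Pos.to_nat vs =i smooth_window 16 16 (Pos.to_nat k) ->
  excess_ge 16 (Pos.to_nat k) (gain k D vs).
Proof.
move=> uvs vsV; set kn := Pos.to_nat k; set V := smooth_window 16 16 kn.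
have uV : uniq V by exact: smooth_window_uniq.
have pV : perm_eq (map Pos.to_nat vs) V.
  by apply: uniq_perm => //; rewrite map_inj_uniq //; exact: Pos2Nat.inj.
rewrite /gain; cbv zeta; set kept := undeleted D.
set L := uf_root 100 (components _ _ _); case: ifP => [/allP H|_]; last exact: excess_ge0.
have ltbE c v : Pos.ltb k (c * v) = (kn < Pos.to_nat c * Pos.to_nat v).
  rewrite -[Pos.to_nat c * _]Pos2Nat.inj_mul /kn.
  by case: Pos.ltb_spec => h; [have := Pos2Nat.inj_lt k (c * v)|have :=
    Pos2Nat.inj_le (c * v) k]; lia.
have cntE (p : pred positive) (q : pred nat) : (forall v, p v = q (Pos.to_nat v)) ->
    count p vs = count q V.
  by move=> pq; rewrite -(permP pV) count_map; apply: eq_count => v /=.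
have szE : size vs = size V by rewrite -(perm_size pV) size_map.
pose knat x := kept (Pos.of_nat x); pose Lnat x := Pos.to_nat (L (Pos.of_nat x)).
have /(pc_ge_labels uV) : {in V &, forall x y, knat x -> knat y -> x %| y -> Lnat x = Lnat y}.
  move=> x y; rewrite -!(perm_mem pV) => /mapP[v vvs ->] /mapP[w wvs ->].
  rewrite /knat /Lnat !Pos2Nat.id => kv kw /dvdnP[r wE].
  have := H v vvs; cbv beta; rewrite kv implyTb => /all_multiplesP Hv.
  have vV : Pos.to_nat v \in V by rewrite -vsV map_f.
  have wV : Pos.to_nat w \in V by rewrite -vsV map_f.
  move: vV wV; rewrite !mem_filter !mem_iota !add1n !ltnS
    => /and3P[/andP[_ kv16] v0 _] /and3P[_ w0 wk].
  (* Positivity excludes [r = 0], [r = 1] gives [w = v], and otherwise [2 <= r <= 15] because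
     [w <= k < 16 * v]. *)
  case: r wE => [|[|r]] wE; first by move: w0; rewrite wE.
    by congr (Pos.to_nat (L _)); apply: Pos2Nat.inj; rewrite wE mul1n.
  have := Hv w; rewrite kw => /(_ _ wk) /= h; congr Pos.to_nat; apply/Pos.eqb_eq; apply: h.
  by exists r; [rewrite wE in wk; nia | rewrite Pos2Nat.inj_add wE; lia].
rewrite /excess_ge -/kn -/V !size_smooth_window // -/V -/(window_pc 16 kn).
rewrite (cntE _ (fun x => knat x && (Lnat x == x))); last first.
  move=> v; rewrite /knat /Lnat Pos2Nat.id; congr (_ && _).
  by apply/idP/eqP => [/Pos.eqb_eq -> //|/Pos2Nat.inj ->]; exact/Pos.eqb_eq.
rewrite (cntE (fun v => ~~ kept v) (predC knat)); last by move=> v; rewrite /= /knat Pos2Nat.id.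
rewrite (cntE _ (fun x => kn < 3 * x)); last by move=> v; rewrite ltbE.
rewrite (cntE _ (fun x => kn < 2 * x)); last by move=> v; rewrite ltbE.
(* [excess_ge0] handles the case where the truncated subtraction in [gain] gives 0. *)
rewrite szE; have := @excess_ge0 16 kn isT; rewrite /excess_ge !size_smooth_window // -/V.
move: (count _ V) (count _ V) (count _ V) (count _ V) => a b c d; lia.
Qed.

Lemma smooth_pos_uniq N : uniq (smooth_pos N).
Proof.
rewrite map_inj_in_uniq ?filter_uniq ?iota_uniq // => x y.
rewrite !mem_filter !mem_iota => /and3P[_ x0 _] /and3P[_ y0 _].
by move/(congr1 Pos.to_nat); rewrite !Nat2Pos.id //; lia.
Qed.

Lemma window_pos_smooth N k : 0 < k <= N ->
  map Pos.to_nat (window_pos (smooth_pos N) (Pos.of_nat k)) =i smooth_window 16 16 k.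
Proof.
move=> /andP[k0 kM] x; rewrite mem_filter mem_iota add1n ltnS.
have kE : Pos.to_nat (Pos.of_nat k) = k by rewrite Nat2Pos.id; lia.
have bE v : (Pos.leb v (Pos.of_nat k) && Pos.ltb (Pos.of_nat k) (16 * v)) =
    (Pos.to_nat v <= k) && (k < 16 * Pos.to_nat v).
  have := Pos2Nat.inj_mul 16 v; rewrite -[Pos.to_nat 16]/16 => E.
  congr (_ && _).
    by case: Pos.leb_spec => h; [have := Pos2Nat.inj_le v (Pos.of_nat k)
      |have := Pos2Nat.inj_lt (Pos.of_nat k) v]; lia.
  by case: Pos.ltb_spec => h; [have := Pos2Nat.inj_lt (Pos.of_nat k) (16 * v)
      |have := Pos2Nat.inj_le (16 * v) (Pos.of_nat k)]; lia.
apply/mapP/idP => [[v]|/andP[/andP[xs kx] /andP[x0 xk]]].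
  rewrite /window_pos mem_filter bE => /andP[/andP[vk kv]]; rewrite /smooth_pos => /mapP[b].
  rewrite mem_filter mem_iota => /andP[bs /andP[b0 _]] vE ->.
  have bv : Pos.to_nat v = b by rewrite vE Nat2Pos.id; lia.
  by rewrite vk kv bv bs b0.
have xE : Pos.to_nat (Pos.of_nat x) = x by rewrite Nat2Pos.id; lia.
exists (Pos.of_nat x); last by rewrite xE.
rewrite /window_pos mem_filter bE xE xk kx /=; apply: map_f.
by rewrite mem_filter xs mem_iota x0 /=; lia.
Qed.

(** The invariant of the loop is that [last] is a valid gain for the length [k.-1]. *)
Lemma gains_sound N m k tg D last : 0 < k -> k + m <= N.+1 -> excess_ge 16 k.-1 last ->
  forall i, i < m ->
  excess_ge 16 (k + i) (nth 0 (gains (smooth_pos N) (iota k m) tg D last) i).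
Proof.
elim: m k tg D last => [//|m IH] k tg D last k0 km Hlast i im.
have kE : Pos.to_nat (Pos.of_nat k) = k by rewrite Nat2Pos.id; lia.
rewrite -[iota k _]/(k :: iota k.+1 m) [gains _ _ _ _ _]/=; case: ifPn => ks.
  set Dt := if tg is _ :: _ then _ else _; case: Dt => D' tg'.
  have H : excess_ge 16 k (gain (Pos.of_nat k) D' (window_pos (smooth_pos N) (Pos.of_nat k))).
    rewrite -{1}kE; apply: gain_sound; first by rewrite filter_uniq // smooth_pos_uniq.
    by rewrite kE; apply: window_pos_smooth; lia.
  by case: i im => [|i] im; rewrite ?addn0 // -addSnnS; apply: IH => //; lia.
have H : excess_ge 16 k last by move: ks Hlast; case: (k) k0 => // k' _; exact: excess_ge_step.
by case: i im => [|i] im; rewrite ?addn0 // -addSnnS; apply: IH => //; lia.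
Qed.

Lemma size_gains sm ks tg D last : size (gains sm ks tg D last) = size ks.
Proof.
elim: ks tg D last => //= k ks IH tg D last; case: ifP => _ /=; last by rewrite IH.
by set Dt := if tg is _ :: _ then _ else _; case: Dt => D' tg' /=; rewrite IH.
Qed.

(** Extended by 0 outside [36 <= j < 1089], where the baseline alone is used. *)
Definition gain_at j := if j < 36 then 0 else nth 0 gain_list (j - 36).

Lemma gain_at_sound j : excess_ge 16 j (gain_at j).
Proof.
rewrite /gain_at; case: ltnP => j36; first exact: excess_ge0.
have [jM|jM] := ltnP (j - 36) 1053; last first.
  by rewrite nth_default ?excess_ge0 // size_gains size_iota.
rewrite -{1}(subnKC j36); apply: gains_sound => //; exact: excess_ge0.
Qed.

(** Sum [gain_at_sound] over the rough [a]. The [n %/ 16] lost in [C_window] cancels against the one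
    missing from the size of the full window, and the baseline leaves about [n / 6]. *)
Lemma C_ge_gain n :
  n + \sum_(1 <= a < n.+1 | (upto 16)^'.-nat a) gain_at (n %/ a) <= C n + n %/ 2 + n %/ 3.
Proof.
have [_ H] := C_window n (isT : 0 < 16); rewrite pc_window_split in H.
have := size_window_split 16 n (isT : 0 < 16).
have := size_window_split 16 n (isT : 0 < 2).
have := size_window_split 16 n (isT : 0 < 3).
have : \sum_(1 <= a < n.+1 | (upto 16)^'.-nat a) (gain_at (n %/ a) +
    size (smooth_window 16 3 (n %/ a)) + size (smooth_window 16 2 (n %/ a))) <=
  \sum_(1 <= a < n.+1 | (upto 16)^'.-nat a)
    (window_pc 16 (n %/ a) + size (smooth_window 16 16 (n %/ a))).
  by apply: leq_sum => a _; exact: gain_at_sound.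
rewrite !big_split /= => h h3 h2 h16; rewrite h3 h2 h16 in h.
have := leq_div n 2; have := leq_div n 3; have := leq_div n 16.
move: H h; set x := \sum_(_ <= _ < _ | _) window_pc _ _; set y := \sum_(_ <= _ < _ | _) _.
move: (n %/ 16) (n %/ 2) (n %/ 3) => u v w; lia.
Qed.

(** * The path cover number is recursive *)

(** Total recursive functions of several variables; the closure lemmas below keep the codes
    implicit. *)
Definition recn n (f : n.-tuple nat -> nat) :=
  exists c : recfun n, forall v, computes c v (f v).

Lemma recn_ext n (f h : n.-tuple nat -> nat) : f =1 h -> recn f -> recn h.
Proof. by move=> fh [c cf]; exists c => v; rewrite -fh. Qed.

Lemma recn_proj n (i : 'I_n) : recn (fun v => tnth v i).
Proof. by exists (RProj i). Qed.

Lemma recn_comp m n (f : m.-tuple nat -> nat) (h : 'I_m -> n.-tuple nat -> nat) :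
  recn f -> (forall i, recn (h i)) -> recn (fun v => f [tuple h i v | i < m]).
Proof.
move=> [c cf] /choice[d dh]; exists (RComp c d) => v /=.
by exists [tuple h i v | i < m]; split=> // i; rewrite tnth_mktuple.
Qed.

Lemma recn_const n k : recn (fun _ : n.-tuple nat => k).
Proof.
elim: k => [|k [c ck]]; first by exists (RZero n).
exists (RComp RSucc (fun=> c)) => v /=; exists [tuple k]; split=> // i.
by rewrite (ord1 i) (tnth_nth 0).
Qed.

Lemma recn_succ n (f : n.-tuple nat -> nat) : recn f -> recn (fun v => (f v).+1).
Proof.
case=> c cf; exists (RComp RSucc (fun=> c)) => v /=; exists [tuple f v]; split=> // i.
by rewrite (ord1 i) (tnth_nth 0).
Qed.

Lemma recn_prec n (f : n.-tuple nat -> nat) (s : n.+2.-tuple nat -> nat)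
    (h : nat -> n.-tuple nat -> nat) :
  recn f -> recn s -> (forall u, h 0 u = f u) ->
  (forall k u, h k.+1 u = s [tuple of k :: h k u :: u]) ->
  recn (fun v : n.+1.-tuple nat => h (thead v) [tuple of behead v]).
Proof.
move=> [c cf] [d ds] h0 hS; exists (RPrec c d) => v /=.
elim: (thead v) => [|k IH]; first by rewrite h0.
by exists (h k [tuple of behead v]); split; rewrite ?hS.
Qed.

Lemma recn_mu n (f : n.+1.-tuple nat -> nat) (h : n.-tuple nat -> nat) :
  recn f -> (forall v, f [tuple of h v :: v] = 0) ->
  (forall v z, z < h v -> f [tuple of z :: v] != 0) -> recn h.
Proof.
move=> [c cf] h0 hS; exists (RMu c) => v /=; split; first by rewrite -(h0 v).
move=> z /hS; have := cf [tuple of z :: v]; case: (f _) => // t ct _.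
by exists t.
Qed.

Lemma recn_head n : recn (fun v : n.+1.-tuple nat => thead v).
Proof. exact: recn_proj. Qed.

Lemma tnth_beheadE n (v : n.+1.-tuple nat) i :
  tnth [tuple of behead v] i = tnth v (lift ord0 i).
Proof.
by rewrite tnth_behead; congr tnth; apply: val_inj; rewrite /= inordK ?ltnS.
Qed.

Lemma recn_behead n (f : n.-tuple nat -> nat) :
  recn f -> recn (fun v : n.+1.-tuple nat => f [tuple of behead v]).
Proof.
move=> rf; have := recn_comp rf (fun i => recn_proj (lift ord0 i)).
apply: recn_ext => v; congr f; apply: eq_from_tnth => i.
by rewrite tnth_mktuple tnth_beheadE.
Qed.

Lemma recn_app1 n (h : nat -> nat) (f : n.-tuple nat -> nat) :
  recn (fun w : 1.-tuple nat => h (thead w)) -> recn f -> recn (fun v => h (f v)).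
Proof.
move=> rh rf; have := @recn_comp 1 n _ (fun=> f) rh (fun=> rf).
by apply: recn_ext => v; rewrite /thead tnth_mktuple.
Qed.

Lemma recn_app2 n (h : nat -> nat -> nat) (f1 f2 : n.-tuple nat -> nat) :
  recn (fun w : 2.-tuple nat => h (thead w) (thead [tuple of behead w])) ->
  recn f1 -> recn f2 -> recn (fun v => h (f1 v) (f2 v)).
Proof.
move=> rh r1 r2.
have := @recn_comp 2 n _ (fun i => if i == ord0 then f1 else f2) rh.
case/(_ _)/Wrap => [i|]; first by case: ifP.
by apply: recn_ext => v; rewrite /thead tnth_beheadE !tnth_mktuple.
Qed.

Lemma recn_add n (f1 f2 : n.-tuple nat -> nat) :
  recn f1 -> recn f2 -> recn (fun v => f1 v + f2 v).
Proof.
apply: recn_app2; apply: (@recn_prec 1 (fun u => thead u)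
  (fun w => (thead [tuple of behead w]).+1) (fun k u => k + thead u)).
- exact: recn_head.
- by apply: recn_succ; apply: recn_behead; exact: recn_head.
- by [].
- by move=> k u; rewrite addSn.
Qed.

(** Bounded sums also provide bounded quantifiers: a sum of truth values is positive exactly when
    some term holds. *)
Lemma recn_sum n (F : nat -> n.-tuple nat -> nat) (e : n.-tuple nat -> nat) :
  recn (fun w : n.+1.-tuple nat => F (thead w) [tuple of behead w]) -> recn e ->
  recn (fun v => \sum_(i < e v) F i v).
Proof.
move=> rF re.
have H : recn (fun w : n.+1.-tuple nat => \sum_(i < thead w) F i [tuple of behead w]).
  apply: (@recn_prec n (fun=> 0) (fun w => thead [tuple of behead w] +
     F (thead w) [tuple of behead [tuple of behead w]]) (fun k u => \sum_(i < k) F i u)).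
  - exact: recn_const.
  - apply: recn_add; first by apply: recn_behead; exact: recn_head.
    (* The recursion step receives the counter, the accumulated sum and the parameters; this choice
       of projections skips the accumulated sum. *)
    have := recn_comp rF (fun i : 'I_n.+1 =>
      @recn_proj n.+2 (if i == ord0 then ord0 else lift ord0 i)).
    apply: recn_ext => v; rewrite /thead tnth_mktuple; congr F.
    by apply: eq_from_tnth => i; rewrite !tnth_beheadE tnth_mktuple.
  - by move=> u; rewrite big_ord0.
  - move=> k u; rewrite big_ord_recr /= addnC addnC; congr (_ + F _ _).
    by apply: val_inj.
have := @recn_comp n.+1 n _ (fun i v => if unlift ord0 i is Some j then tnth v j else e v) H.
case/(_ _)/Wrap => [i|]; first by case: unlift => [j|]; [exact: recn_proj|exact: re].
apply: recn_ext => v; rewrite /thead tnth_mktuple unlift_none.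
apply: eq_bigr => i _; congr F; apply: eq_from_tnth => j.
by rewrite tnth_beheadE tnth_mktuple liftK.
Qed.

Lemma recn_snd n : recn (fun v : n.+2.-tuple nat => thead [tuple of behead v]).
Proof. exact: recn_behead (recn_head n). Qed.

Lemma recn_thd n :
  recn (fun v : n.+3.-tuple nat => thead [tuple of behead [tuple of behead v]]).
Proof. exact: recn_behead (recn_snd n). Qed.

Section Arithmetic.
Variable n : nat.
Implicit Types f h : n.-tuple nat -> nat.

Lemma recn_mul f h : recn f -> recn h -> recn (fun v => f v * h v).
Proof.
move=> rf rh; have := recn_sum (F := fun=> h) (recn_behead rh) rf.
by apply: recn_ext => v; rewrite sum_nat_const card_ord.
Qed.

Lemma recn_pred f : recn f -> recn (fun v => (f v).-1).
Proof.
apply: recn_app1; apply: (@recn_prec 0 (fun=> 0) (fun w => thead w) (fun k u => k.-1)) => //.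
- exact: recn_const.
- exact: recn_head.
Qed.

End Arithmetic.

Lemma recn_subn n (f h : n.-tuple nat -> nat) : recn f -> recn h -> recn (fun v => f v - h v).
Proof.
move=> rf rh; apply: (recn_app2 (h := fun a b => b - a) _ rh rf).
apply: (@recn_prec 1 (fun u => thead u) (fun w => (thead [tuple of behead w]).-1)
  (fun k u => thead u - k)).
- exact: recn_head.
- by apply: recn_pred; exact: recn_snd.
- by move=> u; rewrite subn0.
- by move=> k u; rewrite subnS.
Qed.

Lemma recn_exp n (f h : n.-tuple nat -> nat) : recn f -> recn h -> recn (fun v => f v ^ h v).
Proof.
move=> rf rh; apply: (recn_app2 (h := fun a b => b ^ a) _ rh rf).
apply: (@recn_prec 1 (fun u => 1) (fun w => thead [tuple of behead [tuple of behead w]] *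
  thead [tuple of behead w]) (fun k u => thead u ^ k)).
- exact: recn_const.
- by apply: recn_mul; [exact: recn_thd|exact: recn_snd].
- by [].
- by move=> k u; rewrite expnS; congr (thead _ * _); apply: val_inj.
Qed.

Section Tests.
Variable n : nat.
Implicit Types (f h : n.-tuple nat -> nat) (p q : n.-tuple nat -> bool).

Lemma recn_gt0 f : recn f -> recn (fun v => (0 < f v : nat)).
Proof.
move=> rf; have := recn_subn (recn_const n 1) (recn_subn (recn_const n 1) rf).
by apply: recn_ext => v; case: (f v).
Qed.

Lemma recn_leq f h : recn f -> recn h -> recn (fun v => (f v <= h v : nat)).
Proof.
move=> rf rh; have := recn_subn (recn_const n 1) (recn_subn rf rh).
by apply: recn_ext => v; rewrite -[f v <= h v]subn_eq0; case: (f v - h v).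
Qed.

Lemma recn_not p : recn (fun v => p v : nat) -> recn (fun v => ~~ p v : nat).
Proof. by move/(recn_subn (recn_const n 1)); apply: recn_ext => v; case: (p v). Qed.

Lemma recn_and p q : recn (fun v => p v : nat) -> recn (fun v => q v : nat) ->
  recn (fun v => p v && q v : nat).
Proof. by move=> rp rq; have := recn_mul rp rq; apply: recn_ext => v; rewrite mulnb. Qed.

Lemma recn_or p q : recn (fun v => p v : nat) -> recn (fun v => q v : nat) ->
  recn (fun v => p v || q v : nat).
Proof.
move=> rp rq; have := recn_not (recn_and (recn_not rp) (recn_not rq)).
by apply: recn_ext => v; rewrite negb_and !negbK.
Qed.

Lemma recn_eq f h : recn f -> recn h -> recn (fun v => f v == h v : nat).
Proof.
move=> rf rh; have := recn_and (recn_leq rf rh) (recn_leq rh rf).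
by apply: recn_ext => v; rewrite eqn_leq.
Qed.

End Tests.

(** The quotient counts the positive multiples of [d] up to [m]; the factor [0 < d] matches
    [m %/ 0 = 0]. *)
Lemma divnE m d : m %/ d = (0 < d) * \sum_(i < m) (i.+1 * d <= m).
Proof.
case: d => [|d]; first by rewrite divn0.
rewrite mul1n (eq_bigr (fun i : 'I_m => if i < m %/ d.+1 then 1 else 0)); last first.
  by move=> i _; rewrite leq_divRL //; case: leqP.
rewrite -big_mkcond -(big_ord_widen _ (fun=> 1)) ?leq_div //.
by rewrite sum_nat_const card_ord muln1.
Qed.

Section Division.
Variable n : nat.
Implicit Types f h : n.-tuple nat -> nat.

Lemma recn_div f h : recn f -> recn h -> recn (fun v => f v %/ h v).
Proof.
move=> rf rh.
have H : recn (fun v => (0 < h v) * \sum_(i < f v) (i.+1 * h v <= f v)).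
  apply: recn_mul; first exact: recn_gt0.
  apply: (recn_sum (F := fun i v => (i.+1 * h v <= f v : nat)) _ rf).
  apply: recn_leq; last exact: recn_behead.
  by apply: recn_mul; [apply: recn_succ; exact: recn_head | exact: recn_behead].
by apply: recn_ext H => v; rewrite divnE.
Qed.

Lemma recn_mod f h : recn f -> recn h -> recn (fun v => f v %% h v).
Proof.
move=> rf rh; have := recn_subn rf (recn_mul (recn_div rf rh) rh).
by apply: recn_ext => v; rewrite {1}(divn_eq (f v) (h v)) addKn.
Qed.

Lemma recn_dvd f h : recn f -> recn h -> recn (fun v => f v %| h v : nat).
Proof. by move=> rf rh; apply: recn_eq (recn_mod rh rf) (recn_const _ 0). Qed.

Lemma recn_adj f h : recn f -> recn h -> recn (fun v => divisor_adj (f v) (h v) : nat).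
Proof.
by move=> rf rh; apply: recn_and; [apply: recn_not; exact: recn_eq|apply: recn_or; exact: recn_dvd].
Qed.

End Division.

(** * Permutations coded by their digits *)

Definition digit b w i := (w %/ b ^ i) %% b.

(** If all of [1 .. n] occur among [n] digits, then the digits form a permutation of them. *)
Definition listing n w : bool :=
  \sum_(v < n) (0 < \sum_(i < n) (digit n.+1 w i == v.+1)) == n.

(** This is [druns] of the digit sequence: the index 0 is counted because it opens the first run. *)
Definition listing_runs n w : nat :=
  \sum_(i < n) ~~ ((0 < i) && divisor_adj (digit n.+1 w i.-1) (digit n.+1 w i)).

Lemma recn_listing n (f h : n.-tuple nat -> nat) :
  recn f -> recn h -> recn (fun v => listing (f v) (h v) : nat).
Proof.
move=> rf rh; apply: recn_eq => //.
apply: (recn_sum (F := fun x v => (0 < \sum_(i < f v) (digit (f v).+1 (h v) i == x.+1)) :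
  nat) _ rf).
apply: recn_gt0.
apply: (recn_sum (F := fun i (w : n.+1.-tuple nat) =>
  (digit (f [tuple of behead w]).+1 (h [tuple of behead w]) i == (thead w).+1 :
    nat)) _ (recn_behead rf)).
have rf2 := recn_behead (recn_behead rf); have rh2 := recn_behead (recn_behead rh).
apply: recn_eq; last by apply: recn_succ; exact: recn_snd.
apply: recn_mod (recn_succ rf2); apply: recn_div rh2 _.
exact: recn_exp (recn_succ rf2) (recn_head _).
Qed.

Lemma recn_listing_runs n (f h : n.-tuple nat -> nat) :
  recn f -> recn h -> recn (fun v => listing_runs (f v) (h v)).
Proof.
move=> rf rh; apply: (recn_sum (F := fun i v => ~~ ((0 < i) &&
  divisor_adj (digit (f v).+1 (h v) i.-1) (digit (f v).+1 (h v) i)) : nat) _ rf).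
apply: recn_not; apply: recn_and; first by apply: recn_gt0; exact: recn_head.
have rd e : recn e -> recn (fun w : n.+1.-tuple nat =>
    digit (f [tuple of behead w]).+1 (h [tuple of behead w]) (e w)).
  move=> re; apply: recn_mod (recn_succ (recn_behead rf)).
  exact: recn_div (recn_behead rh) (recn_exp (recn_succ (recn_behead rf)) re).
by apply: recn_adj; apply: rd; [apply: recn_pred|]; exact: recn_head.
Qed.

Lemma runs_mkseq (d : nat -> nat) n :
  druns (mkseq d n) = \sum_(i < n) ~~ ((0 < i) && divisor_adj (d i.-1) (d i)).
Proof.
case: n => [|n]; first by rewrite big_ord0.
rewrite big_ord_recl /= -add1n; congr (1 + _).
have : forall k, breaks divisor_adj (d k) (map d (iota k.+1 n)) =
    \sum_(i < n) ~~ divisor_adj (d (k + i)) (d (k + i).+1).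
  elim: n => [|n IH] k /=; first by rewrite big_ord0.
  rewrite big_ord_recl addn0 IH; congr (_ + _); apply: eq_bigr => i _.
  by rewrite lift0 addSnnS.
by move=> /(_ 0) ->; apply: eq_bigr => i _; rewrite /bump leq0n !add1n !add0n.
Qed.

Lemma encode_digits b (s : seq nat) : all (fun x => x < b) s ->
  exists2 w, w < b ^ size s & forall i, i < size s -> digit b w i = nth 0 s i.
Proof.
elim: s => [|x s IH] /=; first by exists 0.
case/andP=> xb /IH[w ws wd]; exists (w * b + x).
  by rewrite expnSr; nia.
case=> [|i] im; rewrite /digit.
  by rewrite expn0 divn1 modnMDl modn_small.
rewrite expnS divnMA divnMDl; last by apply: leq_ltn_trans xb.
by rewrite (divn_small xb) addn0 -/(digit b w i) wd.
Qed.

Lemma listingP n w : listing n w -> perm_eq (mkseq (digit n.+1 w) n) (iota 1 n).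
Proof.
move/eqP=> H; have sub : {subset iota 1 n <= mkseq (digit n.+1 w) n}.
  move=> x; rewrite mem_iota add1n ltnS => /andP[x0 xn].
  have xn' : x.-1 < n by rewrite prednK.
  have : (0 < \sum_(i < n) (digit n.+1 w i == x)) .
    rewrite lt0n; apply/negP => /eqP E.
    have : \sum_(v < n) (0 < \sum_(i < n) (digit n.+1 w i == v.+1)) < n.
      rewrite -[X in _ < X](card_ord n) -sum1_card (bigD1 (Ordinal xn')) //=.
      rewrite [X in _ < X](bigD1 (Ordinal xn')) //= prednK // E add0n add1n ltnS.
      by apply: leq_sum => v _; case: (0 < _).
    by rewrite H ltnn.
  rewrite lt0n sum_nat_eq0 negb_forall => /existsP[i]; rewrite /= eqb0 negbK => /eqP <-.
  by apply: map_f; rewrite mem_iota /=.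
have sz : size (mkseq (digit n.+1 w) n) <= size (iota 1 n) by rewrite size_mkseq size_iota.
have [_ e] := uniq_min_size (iota_uniq 1 n) sub sz.
apply: uniq_perm; [exact: leq_size_uniq (iota_uniq 1 n) sub sz|exact: iota_uniq|].
by move=> x; rewrite e.
Qed.

Lemma listing_perm n w : perm_eq (mkseq (digit n.+1 w) n) (iota 1 n) -> listing n w.
Proof.
move=> P; apply/eqP; rewrite (eq_bigr (fun=> 1)) ?sum1_card ?card_ord // => v _.
have : v.+1 \in mkseq (digit n.+1 w) n by rewrite (perm_mem P) mem_iota /= add1n ltnS.
case/mapP=> i; rewrite mem_iota /= => iN E.
by rewrite (bigD1 (Ordinal iN)) //= -E eqxx.
Qed.

(** A permutation of [1 .. n] has entries below [n.+1], hence a code below [n.+1 ^ n], so the search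
    is bounded. *)
Lemma C_leP n k : (C n <= k) =
  (0 < \sum_(w < n.+1 ^ n) (listing n w && (listing_runs n w <= k))).
Proof.
apply/idP/idP => [|]; last first.
  rewrite lt0n sum_nat_eq0 negb_forall => /existsP[w] /=; rewrite eqb0 negbK
    => /andP[/listingP P le].
  by apply: leq_trans le; rewrite /listing_runs -(runs_mkseq (digit n.+1 w)); apply: pc_le_runs
    => //; exact: iota_uniq.
rewrite /C; have [s sP <-] := pc_runs_ex (iota_uniq 1 n) => le.
have ss : size s = n by rewrite (perm_size sP) size_iota.
have [|w ws wd] := @encode_digits n.+1 s.
  by apply/allP => x; rewrite (perm_mem sP) mem_iota add1n => /andP[].
rewrite ss in ws wd.
have E : mkseq (digit n.+1 w) n = s.
  apply: (@eq_from_nth _ 0); rewrite size_mkseq ?ss // => i im.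
  by rewrite nth_mkseq // wd.
rewrite lt0n sum_nat_eq0 negb_forall; apply/existsP; exists (Ordinal ws) => /=.
by rewrite eqb0 negbK listing_perm ?E // /listing_runs -(runs_mkseq (digit n.+1 w)) E.
Qed.

Lemma recn_C n (f : n.-tuple nat -> nat) : recn f -> recn (fun v => C (f v)).
Proof.
apply: recn_app1.
pose F (w : 2.-tuple nat) : nat := ~~ (C (thead [tuple of behead w]) <= thead w).
have FE z (v : 1.-tuple nat) : F [tuple of z :: v] = ~~ (C (thead v) <= z).
  by rewrite /F theadE; congr (nat_of_bool (~~ (C (thead _) <= z))); apply: val_inj.
(* [C] is the least [z] at which [F] vanishes. *)
apply: (@recn_mu 1 F).
- apply: recn_not; apply: recn_ext (fun w => congr1 nat_of_bool (esym (C_leP _ _))) _.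
  have r1 := recn_snd 0; have r2 := recn_snd 1.
  apply: recn_gt0; apply: (recn_sum (F := fun w (v : 2.-tuple nat) =>
    (listing (thead [tuple of behead v]) w &&
    (listing_runs (thead [tuple of behead v]) w <= thead v) : nat)) _ (recn_exp (recn_succ r1) r1)).
  apply: recn_and; first exact: recn_listing (recn_behead r1) (recn_head _).
  exact: recn_leq (recn_listing_runs (recn_behead r1) (recn_head _)) r2.
- by move=> v; rewrite FE leqnn.
- by move=> v z; rewrite FE eqb0 negbK -ltnNge.
Qed.

Lemma recn_recursive (h : nat -> nat) :
  recn (fun v : 1.-tuple nat => h (thead v)) -> recursive h.
Proof. by case=> c cf; exists c => k; exact: (cf [tuple k]). Qed.

Local Open Scope ring_scope.

(** * Smooth and rough numbers *)

Lemma big_nat_dvd (V : nmodType) (p n : nat) (P : pred nat) (F : nat -> V) :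
  (0 < p)%N ->
  \sum_(1 <= m < n.+1 | (p %| m)%N && P m) F m =
  \sum_(1 <= k < (n %/ p).+1 | P (p * k)%N) F (p * k)%N.
Proof.
move=> p0; rewrite /index_iota !subSS !subn0 -big_filter_cond.
rewrite (perm_big [seq (p * k)%N | k <- iota 1 (n %/ p)]) /=; first by rewrite big_map.
have inj : injective (muln p) by move=> x y /eqP; rewrite eqn_pmul2l // => /eqP.
apply: uniq_perm; rewrite ?filter_uniq ?map_inj_uniq ?iota_uniq // => m.
rewrite mem_filter mem_iota add1n ltnS; apply/andP/mapP.
  case=> /dvdnP[k ->] /andP[k0 kn]; exists k; last by rewrite mulnC.
  by rewrite mem_iota add1n ltnS leq_divRL // kn andbT; case: k k0 {kn}.
case=> k; rewrite mem_iota add1n ltnS leq_divRL // => /andP[k0 kn] ->.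
by rewrite dvdn_mulr // muln_gt0 p0 k0 mulnC.
Qed.

Section SmoothRough.
Variable R : realType.
Implicit Types (T n k : nat) (s : R).

Definition rough_count T n : R := \sum_(1 <= a < n.+1 | (upto T)^'.-nat a) 1.
Definition rough_density T : R := \prod_(p < T.+1 | prime p) (1 - p%:R^-1).
(** Expanded, this is the sum of [d ^ (s - 1)] over the squarefree [d] with all primes up to [T].
    For [s < 1], [smooth_bound] is the Euler product of the same sum over all smooth [d]. *)
Definition sieve_bound T s : R := \prod_(p < T.+1 | prime p) (1 + p%:R `^ (s - 1)).
Definition smooth_bound T s : R := \prod_(p < T.+1 | prime p) (1 - p%:R `^ (s - 1))^-1.

Lemma prod_primeS (F : nat -> R) T :
  \prod_(p < T.+2 | prime p) F p =
  (\prod_(p < T.+1 | prime p) F p) * (if prime T.+1 then F T.+1 else 1).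
Proof. by rewrite big_mkcond big_ord_recr /= -big_mkcond. Qed.

Lemma prod_prime0 (F : nat -> R) : \prod_(p < 1 | prime p) F p = 1.
Proof. by rewrite big_mkcond big_ord_recr big_ord0 /= mul1r. Qed.

Lemma rough_density0 : rough_density 0 = 1. Proof. exact: (prod_prime0 (fun p => 1 - p%:R^-1)). Qed.
Lemma sieve_bound0 s : sieve_bound 0 s = 1.
Proof. exact: (prod_prime0 (fun p => 1 + p%:R `^ (s - 1))). Qed.
Lemma smooth_bound0 s : smooth_bound 0 s = 1.
Proof. exact: (prod_prime0 (fun p => (1 - p%:R `^ (s - 1))^-1)). Qed.
Lemma rough_densityS T :
  rough_density T.+1 = rough_density T * (if prime T.+1 then 1 - T.+1%:R^-1 else 1).
Proof. exact: (prod_primeS (fun p => 1 - p%:R^-1)). Qed.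
Lemma sieve_boundS T s :
  sieve_bound T.+1 s = sieve_bound T s * (if prime T.+1 then 1 + T.+1%:R `^ (s - 1) else 1).
Proof. exact: (prod_primeS (fun p => 1 + p%:R `^ (s - 1))). Qed.
Lemma smooth_boundS T s :
  smooth_bound T.+1 s = smooth_bound T s * (if prime T.+1 then (1 - T.+1%:R `^ (s - 1))^-1 else 1).
Proof. exact: (prod_primeS (fun p => (1 - p%:R `^ (s - 1))^-1)). Qed.

Lemma upto0_nat a : (0 < a)%N -> (upto 0)^'.-nat a.
Proof.
move=> a0; apply/pnatP => // p pp _; rewrite !inE /=.
by rewrite -ltnNge prime_gt0.
Qed.

Lemma uptoS_nat T a : ~~ prime T.+1 -> (upto T.+1).-nat a = (upto T).-nat a.
Proof.
move=> np; apply: eq_in_pnat => p; rewrite mem_primes => /and3P[pp _ _].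
by rewrite !in_upto leq_eqVlt; case: eqP pp np => [->|] // ->.
Qed.

Lemma uptoS_nat' T a : ~~ prime T.+1 -> (upto T.+1)^'.-nat a = (upto T)^'.-nat a.
Proof.
move=> np; apply: eq_in_pnat => p; rewrite mem_primes => /and3P[pp _ _].
by rewrite !inE /= leq_eqVlt; case: eqP pp np => [->|] // ->.
Qed.

Lemma uptoS_ndvd T a : (0 < a)%N -> prime T.+1 ->
  (upto T.+1)^'.-nat a = ~~ (T.+1 %| a)%N && (upto T)^'.-nat a.
Proof.
move=> a0 pT; apply/pnatP/andP => // [H|[H1 /pnatP H2] p pp pa].
  split; first by apply/negP => Ta; have := H _ pT Ta; rewrite !inE /= leqnn.
  by apply/pnatP => // p pp pa; have := H _ pp pa; rewrite !inE /= -!ltnNge; exact: ltnW.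
have := H2 a0 p pp pa; rewrite !inE /= -!ltnNge => Tp.
rewrite ltn_neqAle Tp andbT; apply: contraNneq H1 => ->; exact: pa.
Qed.

Lemma uptoS_smooth T k : (0 < k)%N -> (upto T.+1).-nat k -> ~~ (T.+1 %| k)%N ->
  (upto T).-nat k.
Proof.
move=> k0 /pnatP H nd; apply/pnatP => // p pp pk; have := H k0 p pp pk.
by rewrite !in_upto leq_eqVlt => /orP[/eqP pE|//]; move: nd; rewrite -pE pk.
Qed.

(** Legendre's recursion: the numbers sieved out by the prime [T.+1] are [T.+1 * a] with [a] free of
    primes up to [T]. *)
Lemma rough_countS T n : prime T.+1 ->
  rough_count T.+1 n = rough_count T n - rough_count T (n %/ T.+1).
Proof.
move=> pT; apply/eqP; rewrite -subr_eq opprK eq_sym; apply/eqP.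
rewrite /rough_count (bigID (fun a => (T.+1 %| a)%N)) /= addrC; congr (_ + _).
  rewrite big_nat_cond [RHS]big_nat_cond; apply: eq_bigl => a.
  by case/boolP: (0 < a < n.+1)%N => //= /andP[a0 _]; rewrite uptoS_ndvd // andbC.
under eq_bigl do rewrite andbC.
rewrite (big_nat_dvd n (fun a => (upto T)^'.-nat a) (fun=> 1)) //.
apply: eq_bigl => a; rewrite pnatM pnatE //= !inE /=.
by rewrite ltnn.
Qed.

Lemma divr_powR s (n k p : nat) : (0 < k)%N -> (0 < p)%N ->
  (n%:R / (k * p)%:R) `^ (1 - s) = (n%:R / k%:R) `^ (1 - s) * p%:R `^ (s - 1) :> R.
Proof.
move=> k0 p0; rewrite natrM invfM mulrA powRM ?divr_ge0 //; congr (_ * _).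
by rewrite -powR_inv1 ?ler0n // -powRrM mulN1r opprB.
Qed.

(** Induction on [T]: for a prime [p = T.+1] the errors at [n / k] and [n / (k * p)] add up, and the
    second carries the extra factor [p ^ (s - 1)]. The general [k] makes the hypothesis apply to
    both. *)
Lemma rough_count_est T n k s : 0 <= s <= 1 -> (0 < k)%N ->
  `|rough_count T (n %/ k) - n%:R / k%:R * rough_density T|
    <= (n%:R / k%:R) `^ (1 - s) * sieve_bound T s.
Proof.
move=> /andP[s0 s1]; elim: T k => [|T IH] k k0.
  rewrite rough_density0 sieve_bound0 !mulr1.
  have -> : rough_count 0 (n %/ k) = (n %/ k)%:R.
    rewrite /rough_count big_nat_cond (eq_bigl (fun a => (0 < a < (n %/ k).+1)%N && true)).
      by rewrite -big_nat_cond sumr_const_nat subSS subn0.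
    by move=> a; rewrite andbT; case/boolP: (0 < a < _)%N => //= /andP[/upto0_nat ->].
  have kR : 0 < k%:R :> R by rewrite ltr0n.
  have x0 : 0 <= n%:R / k%:R :> R by rewrite divr_ge0.
  have -> : n%:R / k%:R = (n %/ k)%:R + (n %% k)%:R / k%:R :> R.
    by rewrite {1}(divn_eq n k) natrD natrM mulrDl mulfK ?gt_eqF.
  rewrite opprD addrA subrr add0r normrN ger0_norm ?divr_ge0 //.
  have f1 : (n %% k)%:R / k%:R <= 1 :> R.
    by rewrite ler_pdivrMr // mul1r ler_nat ltnW // ltn_mod.
  have f0 : 0 <= (n %% k)%:R / k%:R :> R by rewrite divr_ge0.
  (* The error is the fractional part of [x = n / k]. For [x < 1] it is [x], which is at most
     [x ^ (1 - s)]; for [x >= 1] it is at most 1. *)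
  case: (posnP (n %/ k)) => [->|d0].
    rewrite add0r; have [->|fn0] := eqVneq ((n %% k)%:R / k%:R : R) 0; first exact: powR_ge0.
    by apply: ger1_powR; rewrite ?f1 ?andbT ?lt_neqAle ?f0 1?eq_sym ?fn0 //; lra.
  apply: (le_trans f1); rewrite [leLHS](_ : 1 = 1 `^ (1 - s)); last by rewrite powR1.
  apply: ge0_ler_powR; rewrite ?nnegrE ?subr_ge0 ?ler01 ?addr_ge0 //.
  by rewrite -[leLHS]addr0 lerD // ler1n.
have [pT|npT] := boolP (prime T.+1); last first.
  rewrite rough_densityS sieve_boundS (negbTE npT) !mulr1.
  have -> : rough_count T.+1 (n %/ k) = rough_count T (n %/ k).
    by apply: eq_bigl => a; exact: uptoS_nat'.
  exact: IH.
rewrite rough_densityS sieve_boundS pT rough_countS // -divnMA.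
have := IH _ k0; have := IH (k * T.+1)%N; rewrite muln_gt0 k0 => /(_ isT).
rewrite divr_powR // natrM invfM [n%:R * (_ * _)]mulrA.
set x := n%:R / k%:R; set A := rough_count _ _; set B := rough_count _ _.
set q := T.+1%:R `^ _; set i := T.+1%:R^-1 => h1 h2.
have -> : B - A - x * (rough_density T * (1 - i)) = (B - x * rough_density T) - (A - x * i *
  rough_density T) by ring.
apply: le_trans (ler_normB _ _) _.
have -> : x `^ (1 - s) * (sieve_bound T s * (1 + q))
  = x `^ (1 - s) * sieve_bound T s + x `^ (1 - s) * q * sieve_bound T s by ring.
by apply: lerD.
Qed.

Lemma powR_prime_lt1 s (p : nat) : s < 1 -> (1 < p)%N -> p%:R `^ (s - 1) < 1 :> R.
Proof.
move=> s1 p1; have -> : s - 1 = - (1 - s) by ring.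
rewrite powRN invf_lt1 ?powR_gt0 ?ltr0n ?(ltnW p1) //.
have := @gt0_ltr_powR R (1 - s); rewrite subr_gt0 => /(_ s1 1 p%:R).
by rewrite !nnegrE ler01 ler0n ltr1n powR1; apply.
Qed.

Lemma smooth_bound_ge1 T s : s < 1 -> 1 <= smooth_bound T s.
Proof.
move=> s1; apply: (big_ind (fun x => 1 <= x)) => // [x y x1 y1|p pp]; first by rewrite mulr_ege1.
have p1 := prime_gt1 pp; have := powR_prime_lt1 s1 p1.
have := powR_ge0 (p%:R : R) (s - 1) => h0 h1.
rewrite invf_ge1 ?subr_gt0 //; lra.
Qed.

Lemma sieve_bound_ge1 T s : 1 <= sieve_bound T s.
Proof.
apply: (big_ind (fun x => 1 <= x)) => // [x y x1 y1|p pp]; first by rewrite mulr_ege1.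
by rewrite lerDl powR_ge0.
Qed.

Lemma rough_density_itv T : 0 <= rough_density T <= 1.
Proof.
apply: (big_ind (fun x => 0 <= x <= 1)) => [|x y /andP[x0 x1] /andP[y0 y1]|p pp].
- by rewrite ler01 lexx.
- by rewrite mulr_ge0 // mulr_ile1.
have p0 := prime_gt0 pp.
have i1 : p%:R^-1 <= 1 :> R by rewrite invf_le1 ?ltr0n // ler1n.
by rewrite subr_ge0 i1 /= lerBlDr lerDl invr_ge0.
Qed.

(** For a prime [p = T.+1], the terms divisible by [p] are [p ^ (s - 1)] times the same sum up to
    [n / p], whence a strong induction on [n] inside the one on [T]. *)
Lemma smooth_sum_le T s n : s < 1 ->
  \sum_(1 <= k < n.+1 | (upto T).-nat k) k%:R `^ (s - 1) <= smooth_bound T s.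
Proof.
move=> s1; elim: T n => [|T IH] n.
  rewrite smooth_bound0 big_mkcond.
  case: n => [|n]; first by rewrite big_nil.
  rewrite big_ltn // big_nat_cond big1 ?addr0; last first.
    move=> k /andP[/andP[k1 _] _]; case: ifPn => // /pnatP H.
    have := H (ltnW k1) (pdiv k) (pdiv_prime k1) (pdiv_dvd k).
    by rewrite in_upto leqn0 => /eqP h; have := pdiv_gt0 k; rewrite h.
  rewrite Monoid.mulm1 (_ : 1%:R `^ (s - 1) = 1) ?powR1 //.
have [pT|npT] := boolP (prime T.+1); last first.
  rewrite smooth_boundS (negbTE npT) mulr1.
  by under eq_bigl do rewrite uptoS_nat //.
elim/ltn_ind: n => -[|n] IHn.
  by rewrite big_nil (le_trans _ (smooth_bound_ge1 _ s1)).
set q := T.+1%:R `^ (s - 1) : R.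
have q1 : q < 1 by apply: powR_prime_lt1 => //; exact: prime_gt1.
(* The geometric series as a fixed point; its two terms bound the parts prime to [T.+1] and
   divisible by it. *)
have ZE : smooth_bound T.+1 s = smooth_bound T s + q * smooth_bound T.+1 s.
  rewrite smooth_boundS pT -/q; field; lra.
rewrite (bigID (fun k => (T.+1 %| k)%N)) /= addrC ZE; apply: lerD.
  apply: le_trans (IH n.+1); rewrite big_nat_cond [leRHS]big_nat_cond.
  rewrite [leLHS]big_mkcond [leRHS]big_mkcond /=; apply: ler_sum => k _.
  case: ifP => [/andP[/andP[k0 kn] /andP[ks kd]]|_]; last by case: ifP => // _; exact: powR_ge0.
  by rewrite k0 kn (uptoS_smooth _ ks kd) // (andP k0).1.
under eq_bigl do rewrite andbC.
rewrite (big_nat_dvd n.+1 (fun k => (upto T.+1).-nat k) (fun k => k%:R `^ (s - 1))) //.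
rewrite [leLHS](eq_bigr (fun k => q * k%:R `^ (s - 1))); last first.
  by move=> k _; rewrite natrM powRM.
rewrite -mulr_sumr ler_wpM2l ?powR_ge0 //.
have TT : (upto T.+1).-nat T.+1 by rewrite upto_nat_leq // leqnn.
under eq_bigl do rewrite pnatM TT /=.
by apply: IHn; rewrite ltn_Pdiv // prime_gt1.
Qed.

End SmoothRough.

(** * The density *)

Section CauchyEstimate.
Variable R : realType.
Implicit Types (T n k : nat) (s : R).

Lemma rough_countE T n k : (0 < k)%N ->
  rough_count R T (n %/ k) =
  \sum_(1 <= a < n.+1 | (upto T)^'.-nat a && (a * k <= n)%N) 1.
Proof.
move=> k0; rewrite /rough_count (big_nat_widen _ _ n.+1) ?ltnS ?leq_div //.
by apply: eq_bigl => a; rewrite ltnS leq_divRL.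
Qed.

(** These increments live on the smooth [k] and are at most 2 in absolute value, so Abel summation
    moves the sum from rough to smooth numbers. *)
Definition window_pc_diff T k : R := (window_pc T k)%:R - (window_pc T k.-1)%:R.

Lemma sum_window_pc_diff T m : \sum_(1 <= k < m.+1) window_pc_diff T k = (window_pc T m)%:R.
Proof.
elim: m => [|m IH]; first by rewrite big_nil window_pc0.
by rewrite big_nat_recr //= IH /window_pc_diff /= addrC subrK.
Qed.

Lemma window_pc_diff_le T k : (1 < T)%N -> (0 < k)%N ->
  `|window_pc_diff T k| <= if (upto T).-nat k then 2 else 0.
Proof.
case: k => // k T1 _; have := window_pc_step k T1; rewrite /window_pc_diff /=.
case: ifP => _ [A]; last by rewrite A subrr normr0.
move=> B; have := A; have := B; rewrite -!(ler_nat R) !natrD => a b.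
by rewrite ler_norml; apply/andP; split; lra.
Qed.

(** Each [window_pc T (n %/ a)] telescopes over the [k] with [a * k <= n]; exchanging the sums
    counts the rough [a] up to [n %/ k]. *)
Lemma window_sum T n :
  (\sum_(1 <= a < n.+1 | (upto T)^'.-nat a) window_pc T (n %/ a))%:R =
  \sum_(1 <= k < n.+1) window_pc_diff T k * rough_count R T (n %/ k).
Proof.
rewrite natr_sum.
transitivity (\sum_(1 <= a < n.+1 | (upto T)^'.-nat a)
    \sum_(1 <= k < n.+1 | (a * k <= n)%N) window_pc_diff T k).
  rewrite big_nat_cond [RHS]big_nat_cond; apply: eq_bigr => a /andP[/andP[a0 an] _].
  rewrite -sum_window_pc_diff (big_nat_widen _ _ n.+1) ?ltnS ?leq_div //.
  by apply: eq_bigl => k; rewrite ltnS leq_divRL // mulnC.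
rewrite (exchange_big_dep predT) //= big_nat_cond [RHS]big_nat_cond.
apply: eq_bigr => k /andP[/andP[k0 kn] _].
by rewrite rough_countE // mulr_sumr; apply: eq_bigr => a _; rewrite mulr1.
Qed.

(** The main term: [window_sum] divided by [n], with each [rough_count] replaced by [n / k] times
    the rough density. *)
Definition window_mean T n : R :=
  rough_density R T * \sum_(1 <= k < n.+1) window_pc_diff T k / k%:R.

(** Each smooth [k] contributes an error of order [(n / k) ^ (1 - s) / n = n ^ (- s) * k ^ (s - 1)],
    and [smooth_sum_le] adds these up. *)
Lemma window_est T n s : (1 < T)%N -> 0 <= s < 1 -> (0 < n)%N ->
  `|(pc [seq m <- iota 1 n | (n < T * m)%N])%:R / n%:R - window_mean T n|
    <= 2 * n%:R `^ (- s) * (sieve_bound T s * smooth_bound T s).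
Proof.
move=> T1 /andP[s0 s1] n0; rewrite pc_window_split window_sum /window_mean.
have nR : 0 < n%:R :> R by rewrite ltr0n.
rewrite mulr_suml mulr_sumr -sumrB; apply: le_trans (ler_norm_sum _ _ _) _.
apply: (@le_trans _ _ (\sum_(1 <= k < n.+1 | (upto T).-nat k)
   2 * n%:R `^ (- s) * sieve_bound T s * k%:R `^ (s - 1))); last first.
  by rewrite -mulr_sumr mulrA ler_wpM2l ?smooth_sum_le // !mulr_ge0 ?powR_ge0 // (le_trans
    ler01) ?sieve_bound_ge1.
rewrite [leRHS]big_mkcond /= big_nat_cond [leRHS]big_nat_cond.
apply: ler_sum => k /andP[/andP[k0 kn] _].
have kR : 0 < k%:R :> R by rewrite ltr0n.
have -> : window_pc_diff T k * rough_count R T (n %/ k) / n%:R - rough_density R T *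
  (window_pc_diff T k / k%:R) =
   window_pc_diff T k * ((rough_count R T (n %/ k) - n%:R / k%:R * rough_density R T) / n%:R).
  by field; rewrite !gt_eqF.
rewrite normrM; have := window_pc_diff_le T1 k0; case: ifP => _ hk; last first.
  by rewrite (_ : `|window_pc_diff T k| = 0) ?mul0r //; apply/eqP; rewrite eq_le hk normr_ge0.
have -> : 2 * n%:R `^ (- s) * sieve_bound T s * k%:R `^ (s - 1) =
   2 * (((n%:R / k%:R) `^ (1 - s) * sieve_bound T s) / n%:R).
  rewrite powRM ?invr_ge0 ?ler0n // -[k%:R^-1]powR_inv1 ?ler0n // -powRrM mulN1r opprB.
  have -> : n%:R `^ (1 - s) = n%:R * n%:R `^ (- s) :> R.
    rewrite powRD; last by rewrite (gt_eqF nR) implybT.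
    by rewrite powRr1 ?ltW.
  by field; rewrite gt_eqF.
apply: ler_pM => //; rewrite normrM (gtr0_norm (_ : 0 < n%:R^-1)) ?invr_gt0 //.
apply: ler_wpM2r; first by rewrite invr_ge0 ltW.
by apply: rough_count_est => //; rewrite s0 ltW.
Qed.

(** Rankin's trick on the tail: [k > n] gives [1 / k <= n ^ (- s) * k ^ (s - 1)]. *)
Lemma window_mean_cauchy T n N s : (1 < T)%N -> 0 <= s < 1 -> (0 < n <= N)%N ->
  `|window_mean T N - window_mean T n| <= 2 * n%:R `^ (- s) * smooth_bound T s.
Proof.
move=> T1 /andP[s0 s1] /andP[n0 nN]; rewrite /window_mean -mulrBr.
have [W0 W1] := andP (rough_density_itv R T).
rewrite (big_cat_nat (n := n.+1)) //= addrAC subrr add0r normrM (ger0_norm W0).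
apply: le_trans (ler_wpM2r (normr_ge0 _) W1) _; rewrite mul1r.
apply: le_trans (ler_norm_sum _ _ _) _.
apply: (@le_trans _ _ (\sum_(n.+1 <= k < N.+1 | (upto T).-nat k)
   2 * n%:R `^ (- s) * k%:R `^ (s - 1))); last first.
  rewrite -mulr_sumr ler_wpM2l ?mulr_ge0 ?powR_ge0 //.
  apply: le_trans (smooth_sum_le T N s1).
  rewrite [leRHS](big_cat_nat (n := n.+1)) //= lerDr.
  by apply: sumr_ge0 => k _; exact: powR_ge0.
rewrite [leRHS]big_mkcond /= big_nat_cond [leRHS]big_nat_cond.
apply: ler_sum => k /andP[/andP[nk kN] _].
have kR : 0 < k%:R :> R by rewrite ltr0n (leq_trans _ nk).
have nR : 0 < n%:R :> R by rewrite ltr0n.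
rewrite normrM (gtr0_norm (_ : 0 < k%:R^-1)) ?invr_gt0 //.
have := window_pc_diff_le T1 (leq_trans (ltn0Sn _) nk); case: ifP => _ hk; last first.
  by rewrite (_ : `|window_pc_diff T k| = 0) ?mul0r //; apply/eqP; rewrite eq_le hk normr_ge0.
rewrite -mulrA; apply: ler_pM => //.
rewrite powRD; last by rewrite (gt_eqF kR) implybT.
rewrite powR_inv1 ?(ltW kR) // mulrA ler_pMl ?invr_gt0 //.
rewrite powRN ler_pdivlMl ?powR_gt0 // mulr1.
by apply: ge0_ler_powR; rewrite ?nnegrE ?ler0n // ler_nat ltnW.
Qed.

(** Two cuts cost [1 / T] each; [window_est] at [n] and at [N] and [window_mean_cauchy] once cost 2
    each, hence the 6. *)
Lemma density_cauchy T n N s : (1 < T)%N -> 0 <= s < 1 -> (0 < n <= N)%N ->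
  `|(C N)%:R / N%:R - (C n)%:R / n%:R| <=
    2 / T%:R + 6 * n%:R `^ (- s) * (sieve_bound T s * smooth_bound T s).
Proof.
move=> T1 s01 /andP[n0 nN]; have N0 := leq_trans n0 nN.
have cut m : (0 < m)%N -> `|(C m)%:R / m%:R -
    (pc [seq x <- iota 1 m | (m < T * x)%N])%:R / m%:R| <= T%:R^-1 :> R.
  move=> m0; have [A B] := C_window m (ltnW T1).
  have mR : 0 < m%:R :> R by rewrite ltr0n.
  have TR : 0 < T%:R :> R by rewrite ltr0n ltnW.
  rewrite -mulrBl normrM (gtr0_norm (_ : 0 < m%:R^-1)) ?invr_gt0 //.
  rewrite ler_pdivrMr // mulrC.
  have D : (m %/ T)%:R <= m%:R / T%:R :> R.
    by rewrite ler_pdivlMr // -natrM ler_nat leq_trunc_div.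
  move: A B; rewrite -!(ler_nat R) !natrD => A B.
  by rewrite ler_norml; apply/andP; split; lra.
have s1 : s < 1 by case/andP: s01.
have := window_mean_cauchy T1 s01 (introT andP (conj n0 nN)).
have := window_est T1 s01 n0; have := window_est T1 s01 N0.
have := cut n n0; have := cut N N0.
set a := _ / N%:R; set b := _ / N%:R; set c := _ / n%:R; set d := _ / n%:R.
set Zz := sieve_bound T s * _; set t := n%:R `^ _; set t' := N%:R `^ _; set z := smooth_bound T s.
set u := window_mean T N; set v := window_mean T n; set i := T%:R^-1.
have tt' : t' <= t.
  rewrite /t' /t !powRN lef_pV2 ?posrE ?powR_gt0 ?ltr0n //.
  by case/andP: s01 => s0 _; apply: ge0_ler_powR; rewrite ?nnegrE ?ler0n // ler_nat.
have z0 : 0 <= z by apply: le_trans (smooth_bound_ge1 T s1).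
have zZ : z <= Zz by rewrite ler_peMl ?sieve_bound_ge1.
have t0 : 0 <= t by exact: powR_ge0.
have tz : t * z <= t * Zz by rewrite ler_wpM2l.
have t'sieve_bound : t' * Zz <= t * Zz by rewrite ler_wpM2r // (le_trans z0).
rewrite !ler_norml => /andP[h1 h2] /andP[h3 h4] /andP[h5 h6] /andP[h7 h8] /andP[h9 h10].
by apply/andP; split; lra.
Qed.

End CauchyEstimate.

(** * Sums over primes and bounds for the Euler products *)

Section PrimeSums.
Variable R : realType.
Implicit Types (T n m p : nat) (s : R).

Lemma harmonic_le n : (0 < n)%N -> \sum_(1 <= m < n.+1) m%:R^-1 <= 1 + ln n%:R :> R.
Proof.
elim: n => // -[|n] IH _; first by rewrite big_nat1 invr1 lerDl ln1.
rewrite big_nat_recr //=; apply: le_trans (lerD (IH isT) (lexx _)) _.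
rewrite -addrA lerD2l -lerBrDl.
have n1 : 0 < n.+1%:R :> R by rewrite ltr0n.
have n2 : 0 < n.+2%:R :> R by rewrite ltr0n.
have := @le_ln1Dx R (- n.+2%:R^-1).
have -> : 1 + - n.+2%:R^-1 = n.+1%:R / n.+2%:R :> R.
  have n20 : n.+2%:R != 0 :> R by rewrite gt_eqF.
  apply: (mulIf n20); rewrite mulrDl mulNr mulVf // divfK // mul1r.
  by rewrite -[in LHS]addn1 natrD addrK.
rewrite ln_div ?posrE // => H.
have : ln n.+1%:R - ln n.+2%:R <= - n.+2%:R^-1 :> R.
  by apply: H; rewrite ltrN2 invf_lt1 ?ltr1n.
by rewrite lerNr opprB.
Qed.

Definition prime_sum T : R := \sum_(1 <= p < T.+1 | prime p) p%:R^-1.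

Lemma prime_pairs m T :
  (\sum_(1 <= p < T.+1 | prime p && ((p %| m) && prime (m %/ p))) 1 <= 2)%N.
Proof.
rewrite sum1_count -size_filter; set s := [seq _ <- _ | _].
have us : uniq s by rewrite filter_uniq // iota_uniq.
case: (posnP (size s)) => [->//|]; rewrite -has_predT => /hasP[p0].
rewrite mem_filter => /andP[/and3P[pp0 p0m pm] _] _.
apply: (@uniq_leq_size _ s [:: p0; (m %/ p0)%N] us) => p.
rewrite mem_filter => /andP[/and3P[pp pm' _] _]; rewrite !inE.
move: pm'; rewrite -{1}(divnK p0m) Euclid_dvdM // !dvdn_prime2 //.
by rewrite orbC.
Qed.

(** The square is a sum of [1 / m] over products [m] of two primes up to [T], each [m] arising at
    most twice, so the harmonic sum up to [T ^ 2] bounds it. The bound of order [sqrt (ln T)] for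
    [prime_sum] is weaker than that of Mertens but suffices. *)
Lemma prime_sum_sqr T : (0 < T)%N -> prime_sum T ^+ 2 <= 2 * (1 + 2 * ln T%:R).
Proof.
move=> T0; have TR : 0 < T%:R :> R by rewrite ltr0n.
apply: (@le_trans _ _ (2 * \sum_(1 <= m < (T ^ 2).+1) m%:R^-1)); last first.
  rewrite ler_wpM2l //; apply: le_trans (harmonic_le _) _; first by rewrite expn_gt0 T0.
  by rewrite natrX expr2 lnM ?posrE // mulr2n mulrDl mul1r.
rewrite expr2 /prime_sum mulr_suml.
apply: (@le_trans _ _ (\sum_(1 <= p < T.+1 | prime p)
    \sum_(1 <= m < (T ^ 2).+1 | (p %| m)%N && prime (m %/ p)) m%:R^-1)).
  rewrite big_nat_cond [leRHS]big_nat_cond; apply: ler_sum => p /andP[/andP[p0 pT] pp].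
  rewrite (big_nat_dvd (T ^ 2) (fun m => prime (m %/ p)) (fun m => m%:R^-1)) //.
  rewrite [leRHS](eq_bigl prime); last by move=> k /=; rewrite mulKn.
  rewrite mulr_sumr [leRHS](big_cat_nat (n := T.+1)) //=; last first.
    by rewrite ltnS leq_divRL // expnS expn1 leq_mul.
  rewrite [leRHS]addrC -[leLHS]add0r; apply: lerD.
    by apply: sumr_ge0 => k _; rewrite invr_ge0.
  by apply: ler_sum => q _; rewrite natrM invfM.
rewrite (exchange_big_dep predT) //= mulr_sumr; apply: ler_sum => m _.
under eq_bigr do rewrite -[_^-1]mul1r.
rewrite -mulr_suml ler_wpM2r ?invr_ge0 //.
by have := prime_pairs m T; rewrite -(ler_nat R) natr_sum.
Qed.

Lemma prime_sum_ge0 T : 0 <= prime_sum T.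
Proof. by apply: sumr_ge0 => p _; rewrite invr_ge0. Qed.

Lemma prime_ord_sum T (F : nat -> R) :
  \sum_(p < T.+1 | prime p) F p = \sum_(1 <= p < T.+1 | prime p) F p.
Proof. by rewrite -(big_mkord prime) big_ltn_cond. Qed.

Lemma prime_powR_le T s : 0 <= s -> (0 < T)%N ->
  \sum_(p < T.+1 | prime p) p%:R `^ (s - 1) <= T%:R `^ s * prime_sum T.
Proof.
move=> s0 T0; rewrite (prime_ord_sum T (fun p => p%:R `^ (s - 1))) /prime_sum mulr_sumr.
rewrite big_nat_cond [leRHS]big_nat_cond; apply: ler_sum => p /andP[/andP[p0 pT] _].
have pR : 0 < p%:R :> R by rewrite ltr0n.
rewrite powRD; last by rewrite (gt_eqF pR) implybT.
rewrite powR_inv1; last exact: ltW.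
apply: ler_wpM2r; first by rewrite invr_ge0 ltW.
by apply: ge0_ler_powR; rewrite ?nnegrE ?ler0n // ler_nat.
Qed.

(** For [s <= 1/2], [q = p ^ (s - 1)] satisfies [q ^ 2 <= 1/2], so [q <= 3/4]; then
    [1 + q <= expR q] and [1 / (1 - q) <= 1 + 4 * q <= expR (4 * q)]. *)
Lemma bounds_le_expR_prime_sum T s : 0 <= s <= 2^-1 ->
  sieve_bound T s * smooth_bound T s <= expR (5 * \sum_(p < T.+1 | prime p) p%:R `^ (s - 1)).
Proof.
move=> /andP[s0 s1]; rewrite /sieve_bound /smooth_bound -big_split /= mulr_sumr expR_sum.
apply: ler_prod => p pp.
have p1 := prime_gt1 pp.
set q := p%:R `^ (s - 1); have q0 : 0 <= q by exact: powR_ge0.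
have q34 : q <= 3 / 4.
  have : q ^+ 2 <= (3 / 4) ^+ 2.
    rewrite -powR_mulrn // /q -powRrM; apply: (@le_trans _ _ (2^-1)); last by lra.
    rewrite -[leRHS]powR_inv1 //; apply: (@le_trans _ _ (p%:R `^ (-1))).
      apply: ler_powR; [by rewrite ler1n prime_gt0|lra].
    rewrite !powR_inv1 // lef_pV2 ?posrE ?ltr0n ?prime_gt0 //.
    by rewrite ler_nat.
  by rewrite ler_pXn2r ?nnegrE //; lra.
apply/andP; split.
  by rewrite divr_ge0 //; lra.
have -> : 5 * q = q + 4 * q by ring.
rewrite expRD; apply: ler_pM; rewrite ?invr_ge0; [lra|lra|exact: expR_ge1Dx|].
apply: le_trans (expR_ge1Dx _).
rewrite -[leLHS]mul1r ler_pdivrMr; last by lra.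
nra.
Qed.

Lemma bounds_le_expR_sqrt T s : 0 <= s <= 2^-1 -> (0 < T)%N ->
  sieve_bound T s * smooth_bound T s <= expR (5 * (T%:R `^ s * Num.sqrt (2 * (1 + 2 * ln T%:R)))).
Proof.
move=> s01 T0; apply: le_trans (bounds_le_expR_prime_sum T s01) _; rewrite ler_expR ler_wpM2l //.
case/andP: s01 => s0 _; apply: le_trans (prime_powR_le s0 T0) _.
rewrite ler_wpM2l ?powR_ge0 // -(ger0_norm (prime_sum_ge0 T)) -sqrtr_sqr.
by rewrite ler_wsqrtr // prime_sum_sqr.
Qed.

(** A cruder bound with an integer exponent, which keeps the choices in the computability proof
    explicit. *)
Lemma bounds_le_expR T s : 0 <= s <= 2^-1 ->
  sieve_bound T s * smooth_bound T s <= expR (5 * T.+1%:R).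
Proof.
move=> s01; apply: le_trans (bounds_le_expR_prime_sum T s01) _; rewrite ler_expR ler_wpM2l //.
apply: (@le_trans _ _ (\sum_(p < T.+1) 1)); last by rewrite sumr_const card_ord.
rewrite big_mkcond; apply: ler_sum => p _; case: ifP => // pp.
by rewrite ltW // powR_prime_lt1 ?prime_gt1 //; lra.
Qed.

End PrimeSums.

(** * The limit of [C n / n] and its rate *)

Section Density.
Local Open Scope classical_set_scope.
Local Open Scope ring_scope.
Variable R : realType.
Implicit Types (T n : nat) (s : R).

Definition density_err T s n : R :=
  2 / T%:R + 6 * n%:R `^ (- s) * (sieve_bound T s * smooth_bound T s).

(** By [density_cauchy] at the larger of two arguments, every lower end [u n - density_err T s n]
    lies below every upper end. The supremum of the lower ends thus serves all [T], [s] and [n] at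
    once. *)
Lemma density_exists : exists c : R, forall T s n,
  (1 < T)%N -> 0 <= s < 1 -> (0 < n)%N ->
  `|(C n)%:R / n%:R - c| <= density_err T s n.
Proof.
pose u n : R := (C n)%:R / n%:R.
pose A : set R := [set x | exists T s n,
  [/\ (1 < T)%N, 0 <= s < 1, (0 < n)%N & x = u n - density_err T s n]].
have le_cross T s n T' s' n' : (1 < T)%N -> 0 <= s < 1 -> (0 < n)%N ->
    (1 < T')%N -> 0 <= s' < 1 -> (0 < n')%N ->
    u n - density_err T s n <= u n' + density_err T' s' n'.
  move=> T1 s1 n0 T1' s1' n0'.
  have := density_cauchy (n := n) (N := maxn n n') T1 s1; rewrite leq_maxl n0 => /(_ isT).
  have := density_cauchy (n := n') (N := maxn n n') T1' s1'; rewrite leq_maxr n0' => /(_ isT).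
  rewrite -/(density_err _ _ _) -/(density_err _ _ _) -!/(u _).
  rewrite !ler_norml => /andP[a b] /andP[a' b']; lra.
have hs : 0 <= (0 : R) < 1.
  by rewrite lexx ltr01.
have Aub T s n : (1 < T)%N -> 0 <= s < 1 -> (0 < n)%N -> ubound A (u n + density_err T s n).
  by move=> T1 s1 n0 x [T' [s' [n' [? ? ? ->]]]]; exact: le_cross.
have A0 : A !=set0 by exists (u 1%N - density_err 2 0 1), 2%N, 0, 1%N.
have supA : has_sup A by split => //; exists (u 1%N + density_err 2 0 1); exact: Aub.
exists (sup A) => T s n T1 s1 n0.
have h1 : u n - density_err T s n <= sup A by apply: ub_le_sup; [case: supA|exists T, s, n].
have h2 : sup A <= u n + density_err T s n by apply: ge_sup => //; exact: Aub.
by rewrite -/(u n) ler_norml; apply/andP; split; lra.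
Qed.

Lemma density_err_le n : 400 ^+ 4 <= ln (ln n%:R) :> R -> (0 < n)%N ->
  let L := Num.sqrt (ln n%:R * ln (ln n%:R)) in
  exists T s, [/\ (1 < T)%N, 0 <= s < 1 &
    density_err T s n <= 8 * expR (- (9 / 20 * L))].
Proof.
move=> hl n0 L; set l := ln (ln n%:R) in hl L *; set X := ln n%:R in l hl L *.
have l0 : 400 <= l by apply: le_trans hl; rewrite -[leLHS]mulr1 exprS ler_wpM2l // exprn_ege1 //
  ler1n.
have X0 : 0 < X by rewrite ltNge; apply/negP => /ln0 E; move: l0; rewrite /l E; lra.
have eX : expR l = X by rewrite /l lnK ?posrE.
have lX : l <= X by rewrite -eX; apply: le_trans (expR_ge1Dx _); lra.
have L2 : L ^+ 2 = X * l by rewrite sqr_sqrtr // mulr_ge0 //; lra.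
have L0 : 0 <= L by exact: sqrtr_ge0.
have lL : l <= L by rewrite -ler_sqr ?nnegrE //; [rewrite L2 expr2 ler_wpM2r //; lra|lra].
set e := expR (L / 2); have e1 : 1 <= e by rewrite -expR0 ler_expR; lra.
set T := (Num.trunc e).+1.
have [Te eT] : T%:R <= 2 * e /\ e < T%:R.
  have /andP[h1 h2] := truncn_itv (le_trans ler01 e1 : 0 <= e).
  by split=> //; rewrite /T -natr1; lra.
exists T, (l / (2 * L)).
have Lp : 0 < L by lra.
have s0 : 0 <= l / (2 * L) by rewrite divr_ge0 //; lra.
have s1 : l / (2 * L) <= 2^-1.
  by rewrite ler_pdivrMr; [rewrite mulrA mulVf ?mul1r // pnatr_eq0|lra].
have T1 : (1 < T)%N by rewrite -(ltr_nat R); apply: le_lt_trans eT.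
have T0 := ltnW T1.
split; [exact: T1|rewrite s0; lra|].
have TR : 0 < T%:R :> R by rewrite ltr0n.
have b1 : 2 / T%:R <= 2 * expR (- (L / 2)).
  by rewrite ler_wpM2l // expRN lef_pV2 ?posrE ?expR_gt0 // ltW.
(* [L ^+ 2 = X * l] makes [s * ln n] equal to [L / 2]. *)
have b2 : n%:R `^ (- (l / (2 * L))) = expR (- (L / 2)).
  rewrite /powR pnatr_eq0 -leqn0 leqNgt n0 /= -/X; congr expR.
  have : l * X = L ^+ 2 by rewrite L2 mulrC.
  by move=> h; rewrite mulNr mulrAC h expr2; field; rewrite gt_eqF.
have b3 : T%:R `^ (l / (2 * L)) <= 2 * expR (l / 4).
  apply: (@le_trans _ _ ((2 * e) `^ (l / (2 * L)))).
    by apply: ge0_ler_powR => //; rewrite nnegrE ?ler0n // mulr_ge0 ?expR_ge0.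
  rewrite powRM ?expR_ge0 //.
  apply: ler_pM; rewrite ?powR_ge0 //.
    by apply: le_trans (ler1_powR _ _); lra.
  rewrite -expRM ler_expR le_eqVlt; apply/orP; left; apply/eqP.
  by field; rewrite gt_eqF.
have b4 : Num.sqrt (2 * (1 + 2 * ln T%:R)) <= 2 * Num.sqrt L.
  have -> : 2 * Num.sqrt L = Num.sqrt (4 * L).
    by rewrite sqrtrM // (_ : 4 = 2 ^+ 2) ?sqrtr_sqr ?ger0_norm // -natrX.
  apply: ler_wsqrtr.
  have : ln T%:R <= ln (2 * e) by rewrite ler_ln ?posrE //; lra.
  rewrite lnM ?posrE //; last lra.
  rewrite expRK; have : ln 2 < 2 :> R by exact: ln_sublinear.
  lra.
(* Fourth powers are compared: that of [Num.sqrt L] is [L ^+ 2 = l * expR l], and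
   [400 ^+ 4 <= l]. *)
have b5 : 400 * expR (l / 4) <= Num.sqrt L.
  have p0 : 0 <= 400 * expR (l / 4) :> R by rewrite mulr_ge0 ?expR_ge0.
  rewrite -(ger0_norm p0) -sqrtr_sqr; apply: ler_wsqrtr.
  rewrite -(ler_pXn2r (n := 2)) ?nnegrE ?exprn_ge0 // -exprM L2 exprMn.
  rewrite -expRM_natl (_ : (2 * 2)%:R * (l / 4) = l); last by field.
  by rewrite eX [X * l]mulrC ler_wpM2r // ltW.
(* The exponent is at most [5 * (2 * expR (l / 4)) * (2 * Num.sqrt L)], hence at most
   [20 * (L / 400)] by [b5]. *)
have b6 : sieve_bound T (l / (2 * L)) * smooth_bound T (l / (2 * L)) <= expR (L / 20).
  apply: le_trans (bounds_le_expR_sqrt _ T0) _; first by rewrite s0.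
  rewrite ler_expR; set S := Num.sqrt L in b4 b5 *.
  have S2 : S * S = L by rewrite -expr2 sqr_sqrtr.
  have S0 : 0 <= S by exact: sqrtr_ge0.
  have h := ler_pM (powR_ge0 _ _) (sqrtr_ge0 _) b3 b4.
  have : expR (l / 4) * S <= S / 400 * S by rewrite ler_wpM2r //; lra.
  move: h; set a := _ `^ _ * _; set b := expR _; move=> h h'.
  have : S / 400 * S = L / 400 by rewrite mulrAC S2.
  by move=> E; rewrite E in h'; lra.
rewrite /density_err b2.
have -> : - (9 / 20 * L) = - (L / 2) + L / 20 by lra.
rewrite expRD; set y := expR (- (L / 2)) in b1 *; have y0 : 0 <= y by exact: expR_ge0.
set z := expR (L / 20) in b6 *; have z1 : 1 <= z by rewrite -expR0 ler_expR; lra.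
have h6 : y * (sieve_bound T (l / (2 * L)) * smooth_bound T (l / (2 * L)))
  <= y * z by rewrite ler_wpM2l.
have h7 : y <= y * z by rewrite ler_peMr.
lra.
Qed.

End Density.

(** * The lower bound *)

Section LowerBound.
Variable R : realType.

Lemma N_to_nat_le a b : N.le a b -> (N.to_nat a <= N.to_nat b)%N.
Proof. by move=> ab; lia. Qed.

Let toR (x : N) : R := (N.to_nat x)%:R.

Lemma gain_sum_le scale j l : (0 < N.to_nat j)%N ->
  toR (gain_sum scale j l) <= toR scale *
    \sum_(i < size l) (nth 0%N l i)%:R / ((N.to_nat j + i)%:R * (N.to_nat j + i).+1%:R).
Proof.
elim: l j => [|c l IH] j j0; first by rewrite big_ord0 mulr0.
rewrite [gain_sum _ _ _]/= [size _]/= big_ord_recl mulrDr /toR N2Nat.inj_add plusE [leLHS]natrD.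
have jS : N.to_nat (N.succ j) = (N.to_nat j).+1 by rewrite N2Nat.inj_succ.
apply: lerD.
  rewrite addn0 mulrCA mulrA; set q := N.div _ _.
  have nj : (0 : R) < (N.to_nat j)%:R * (N.to_nat j).+1%:R by rewrite mulr_gt0 ?ltr0n.
  rewrite ler_pdivlMr // -!natrM ler_nat -jS.
  have : N.le (N.mul (N.mul j (N.succ j)) q) (N.mul (N.of_nat c) scale).
    exact: N.Div0.mul_div_le.
  move=> /N_to_nat_le; rewrite !N2Nat.inj_mul Nat2N.id !multE mulnC; apply.
have := IH (N.succ j); rewrite jS => /(_ isT) H; apply: le_trans H _.
by rewrite le_eqVlt; apply/orP; left; apply/eqP; congr (_ * _); apply: eq_bigr => i _;
  rewrite /= !addSnnS.
Qed.

(** The rough [a] are grouped by [j = n %/ a]; those with a given [j] are counted by a difference of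
    two rough counts. *)
Lemma gain_at_sum n :
  (\sum_(1 <= a < n.+1 | (upto 16)^'.-nat a) gain_at (n %/ a))%:R =
  \sum_(36 <= j < 1089) (gain_at j)%:R *
    (rough_count R 16 (n %/ j) - rough_count R 16 (n %/ j.+1)).
Proof.
rewrite natr_sum.
transitivity (\sum_(1 <= a < n.+1 | (upto 16)^'.-nat a) \sum_(36 <= j < 1089)
   (gain_at j)%:R * ((a * j <= n)%N%:R - (a * j.+1 <= n)%N%:R) : R).
  rewrite big_nat_cond [RHS]big_nat_cond; apply: eq_bigr => a /andP[/andP[a0 _] _].
  rewrite (eq_bigr (fun j => if j == (n %/ a)%N then (gain_at j)%:R else 0 : R)); last first.
    move=> j _; rewrite ![(a * _)%N]mulnC -!leq_divRL //.
    case: (ltngtP j (n %/ a)%N) => _ /=; first by rewrite subrr mulr0.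
      by rewrite subrr mulr0.
    by rewrite subr0 mulr1.
  rewrite -big_mkcond big_nat1_eq; case: ifP => // /negbT.
  rewrite negb_and -!ltnNge /gain_at => /orP[->//|h].
  case: ltnP => // h36; rewrite nth_default // size_gains size_iota; lia.
rewrite exchange_big big_nat_cond [RHS]big_nat_cond /=.
apply: eq_bigr => j /andP[/andP[j0 _] _].
rewrite -mulr_sumr sumrB !rough_countE ?(leq_trans _ j0) //.
congr (_ * (_ - _)); rewrite big_mkcond [RHS]big_mkcond; apply: eq_bigr => a _;
  by case: (_.-nat a); case: (_ <= n)%N.
Qed.

Definition gain_density : R := \sum_(36 <= j < 1089) (gain_at j)%:R * (j%:R^-1 - j.+1%:R^-1).

(** At the square [n = m ^ 2] and [s = 1/2], the sieve error is at most [m] times a constant, with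
    no fractional power left. *)
Lemma C_ge_density m : (0 < m)%N ->
  (6^-1 + rough_density R 16 * gain_density) * (m ^ 2)%:R -
    2 * m%:R * sieve_bound 16 2^-1 * \sum_(36 <= j < 1089) (gain_at j)%:R <= (C (m ^ 2))%:R :> R.
Proof.
move=> m0; set n := (m ^ 2)%N; set SG := \sum_(_ <= _ < _) _.
have n0 : (0 < n)%N by rewrite expn_gt0 m0.
have := C_ge_gain n; rewrite -(ler_nat R) !natrD gain_at_sum => H.
have half (d : nat) : (0 < d)%N -> (n %/ d)%:R <= n%:R / d%:R :> R.
  by move=> d0; rewrite ler_pdivlMr ?ltr0n // -natrM ler_nat leq_trunc_div.
have h2 := half 2 isT; have h3 := half 3 isT.
have est j : (0 < j)%N -> `|rough_count R 16 (n %/ j) - n%:R / j%:R * rough_density R 16|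
  <= m%:R * sieve_bound 16 2^-1.
  move=> j0; have s12 : 0 <= (2^-1 : R) <= 1 by lra.
  apply: le_trans (@rough_count_est R 16 n j 2^-1 s12 j0) _.
  rewrite (_ : 1 - 2^-1 = 2^-1); last by lra.
  rewrite ler_wpM2r ?(le_trans ler01 (sieve_bound_ge1 _ _)) //.
  apply: (@le_trans _ _ (n%:R `^ 2^-1)).
    apply: ge0_ler_powR; rewrite ?nnegrE ?divr_ge0 ?ler0n //.
    by rewrite ler_pdivrMr ?ltr0n // ler_peMr // ler1n.
  by rewrite powR12_sqrt // natrX sqrtr_sqr ger0_norm.
have : n%:R * rough_density R 16 * gain_density - 2 * m%:R * sieve_bound 16 2^-1 * SG <=
   \sum_(36 <= j < 1089) (gain_at j)%:R *
    (rough_count R 16 (n %/ j) - rough_count R 16 (n %/ j.+1)).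
  rewrite /gain_density !mulr_sumr -sumrB big_nat_cond [leRHS]big_nat_cond.
  apply: ler_sum => j /andP[/andP[j36 _] _].
  have j0 : (0 < j)%N by apply: leq_trans j36.
  rewrite mulrCA [X in _ - X]mulrC -mulrBr ler_wpM2l //.
  have := est j j0; have := est j.+1 isT; rewrite !ler_norml.
  move: (rough_count R 16 (n %/ j)) (rough_count R 16 (n %/ j.+1)) (rough_density R 16)
    (sieve_bound 16 2^-1)
    (j%:R^-1 : R) (j.+1%:R^-1 : R) (n%:R : R) (m%:R : R) => a b w z i i' x y.
  move=> /andP[a1 a2] /andP[b1 b2]; lra.
set t := rough_density R 16 * gain_density; set u := _ * _ * _ * SG.
set s := \sum_(_ <= _ < _) _ in H *.
rewrite (_ : n%:R * rough_density R 16 * _ = t * n%:R); last by rewrite /t; ring.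
move=> K; rewrite mulrDl; lra.
Qed.

Lemma density_ge (c : R) : (forall T s n, (1 < T)%N -> 0 <= s < 1 -> (0 < n)%N ->
    `|(C n)%:R / n%:R - c| <= density_err T s n) ->
  6^-1 + rough_density R 16 * gain_density <= c.
Proof.
move=> Hc; set v := _ + _; rewrite leNgt; apply/negP => cv.
pose T := (Num.trunc (4 / (v - c))).+2.
pose B : R := sieve_bound T 2^-1 * smooth_bound T 2^-1.
pose SG : R := \sum_(36 <= j < 1089) (gain_at j)%:R.
(* [K / m] collects the errors of order [1 / m] from [density_err] and from [C_ge_density]. *)
pose K := 6 * B + 2 * sieve_bound 16 2^-1 * SG.
pose m := (Num.trunc (2 * K / (v - c))).+1.
have d0 : 0 < v - c by rewrite subr_gt0.
have hT : 2 / T%:R < (v - c) / 2.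
  have : 4 / (v - c) < T%:R.
    by apply: lt_trans (truncnS_gt _) _; rewrite ltr_nat.
  rewrite ltr_pdivrMr // => h; rewrite ltr_pdivrMr ?ltr0n //; lra.
have mR : 0 < m%:R :> R by rewrite ltr0n.
have hm : K / m%:R < (v - c) / 2.
  have : 2 * K / (v - c) < m%:R by exact: truncnS_gt.
  rewrite ltr_pdivrMr // => h; rewrite ltr_pdivrMr //; lra.
have s12 : 0 <= (2^-1 : R) < 1 by lra.
have := Hc T 2^-1 (m ^ 2)%N isT s12; rewrite expn_gt0 => /(_ isT).
rewrite /density_err -/B ler_norml => /andP[_].
have -> : (m ^ 2)%:R `^ (- 2^-1) = m%:R^-1 :> R.
  by rewrite powRN powR12_sqrt // natrX sqrtr_sqr ger0_norm // ltW.
have := C_ge_density (ltn0Sn _ : (0 < m)%N); rewrite -/v -/SG natrX expr2.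
set Cm := (C _)%:R; move=> h1 h2.
have h3 : v - 2 * sieve_bound 16 2^-1 * SG / m%:R <= Cm / (m%:R * m%:R).
  rewrite ler_pdivlMr ?mulr_gt0 //; apply: le_trans h1.
  rewrite le_eqVlt; apply/orP; left; apply/eqP; field; exact: lt0r_neq0.
have E : K / m%:R = 6 * m%:R^-1 * B + 2 * sieve_bound 16 2^-1 * SG / m%:R by rewrite /K; field;
  exact: lt0r_neq0.
move: h2 h3 hm; rewrite E; set a := Cm / _; set b := 2 / T%:R in hT *; lra.
Qed.

Lemma rough_density16 : rough_density R 16 = 192 / 1001.
Proof.
rewrite !rough_densityS rough_density0 (_ : prime 16 = false) // (_ : prime 15 = false) // (_ :
  prime 14 = false) // (_
  : prime 13 = true) // (_ : prime 12 = false) // (_ : prime 11 = true) // (_ :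
  prime 10 = false) // (_ : prime 9 = false) // (_ : prime 8 = false) // (_ :
  prime 7 = true) // (_ : prime 6 = false) // (_ : prime 5 = true) // (_ : prime 4
  = false) // (_ : prime 3 = true) // (_ : prime 2 = true) // (_ : prime 1 =
  false) //.
lra.
Qed.

Lemma gain_sum_density (l : seq nat) (scale : N) : N.lt 0 scale ->
  N.leb (N.mul 41 scale) (N.mul 800 (gain_sum scale 36 l)) ->
  41 / 800 <= \sum_(i < size l) (nth 0%N l i)%:R / ((36 + i)%:R * (36 + i).+1%:R) :> R.
Proof.
move=> scale0 /N.leb_le /N_to_nat_le.
rewrite !N2Nat.inj_mul !multE -[N.to_nat 41]/41%N -[N.to_nat 800]/800%N.
rewrite -(ler_nat R) !natrM -!/(toR _) => H.
have := @gain_sum_le scale 36 l isT; rewrite -[N.to_nat 36]/36%N.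
have s0 : 0 < toR scale by rewrite ltr0n; lia.
move: (toR scale) (toR (gain_sum _ _ _)) (\sum_(_ < _) _) s0 H => x y z x0 H K.
have {}H : 41 * x <= 800 * z * x.
  by lra.
have {}H : 41 <= 800 * z by rewrite -(ler_pM2r x0).
lra.
Qed.

Lemma inv_mul_succ j : (0 < j)%N -> (j%:R * j.+1%:R)^-1 = j%:R^-1 - j.+1%:R^-1 :> R.
Proof.
move=> j0; have jR : 0 < j%:R :> R by rewrite ltr0n.
by rewrite -natr1; field; apply/andP; split; rewrite gt_eqF //; lra.
Qed.

Lemma gain_density_ge : 41 / 800 <= gain_density.
Proof.
have := gain_sum_density (erefl : N.lt 0 1000000000000) gain_sum_ge.
rewrite size_gains size_iota => h; apply: le_trans h _; rewrite le_eqVlt; apply/orP; left;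
  apply/eqP.
rewrite /gain_density -(big_mkord xpredT (fun i => (nth 0%N gain_list i)%:R / ((36 + i)%:R * (36
  + i).+1%:R))).
rewrite [RHS](big_addn 0 1089 36); apply: eq_big_nat => i _.
rewrite /gain_at ltnNge leq_addl /= addnK; congr (_ * _).
by rewrite [(i + 36)%N]addnC inv_mul_succ.
Qed.

Lemma density_lb (c : R) : (forall T s n, (1 < T)%N -> 0 <= s < 1 -> (0 < n)%N ->
    `|(C n)%:R / n%:R - c| <= density_err T s n) ->
  (176 * 10 ^+ 3 + 488) / 10 ^+ 6 < c.
Proof.
move=> /density_ge; have := gain_density_ge; rewrite rough_density16 => h; lra.
Qed.

End LowerBound.

(** * Conclusion *)

Local Open Scope classical_set_scope.
Local Open Scope ring_scope.

Section Computability.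
Variable R : realType.

Lemma expR1_le4 : expR 1 <= 4 :> R.
Proof.
have := @expR_ge1Dx R (- 2^-1); rewrite expRN => h.
have h2 : expR 2^-1 <= 2 :> R.
  rewrite -[leLHS]invrK -[leRHS]invrK lef_pV2 ?posrE ?invr_gt0 ?expR_gt0 //; lra.
rewrite [X in expR X](_ : 1 = 2^-1 + 2^-1) ?expRD; last by lra.
have := ler_pM (expR_ge0 _) (expR_ge0 _) h2 h2; lra.
Qed.

(** With [T = 2 ^ (k + 2)] the first term is half of [2 ^- k]. The argument is [2 ^ (64 * T)], whose
    inverse square root [2 ^- (32 * T)] beats the Euler products, which are at most
    [4 ^ (5 * T.+1)]. *)
Lemma density_err_dyadic k :
  density_err (2 ^ (k + 2))%N 2^-1 (2 ^ (2 ^ (k + 8)))%N <= 2 ^- k :> R.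
Proof.
set T := (2 ^ (k + 2))%N.
have T4 : (k + 4 <= 2 * T)%N.
  rewrite /T expnD mulnC -mulnA; have := ltn_expl k (isT : 1 < 2)%N.
  by move: (2 ^ k)%N => x; lia.
have -> : (2 ^ (2 ^ (k + 8)) = (2 ^ (32 * T)) ^ 2)%N.
  by rewrite -expnM /T -(expnD 2 5) -expnSr; congr (2 ^ (2 ^ _))%N; lia.
rewrite /density_err powRN powR12_sqrt // natrX sqrtr_sqr ger0_norm // natrX.
have s12 : 0 <= (2^-1 : R) <= 2^-1 by rewrite lexx andbT invr_ge0.
have B : sieve_bound T 2^-1 * smooth_bound T 2^-1 <= 2 ^+ (10 * T.+1) :> R.
  apply: le_trans (bounds_le_expR T s12) _.
  rewrite -natrM -[_%:R]mulr1 expRM_natl (_ : (10 * T.+1 = 2 * (5 * T.+1))%N); last by lia.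
  rewrite [leRHS]exprM (_ : 2 ^+ 2 = 4 :> R); last by lra.
  by apply: lerXn2r; rewrite ?nnegrE ?expR_ge0 // expR1_le4.
have -> : 2 / T%:R = 2^-1 * 2 ^- k :> R.
  by rewrite natrX exprD invfM; field; rewrite expf_neq0.
have h : 6 * (2 ^+ (32 * T))^-1 * (sieve_bound T 2^-1 * smooth_bound T 2^-1) <= 2^-1 * 2 ^- k :> R.
  rewrite mulrAC ler_pdivrMr ?exprn_gt0 //.
  apply: (@le_trans _ _ (8 * 2 ^+ (10 * T.+1))).
    have : 0 <= 2 ^+ (10 * T.+1) :> R by rewrite exprn_ge0.
    by move: (_ ^+ _) (sieve_bound _ _ * _) B => P z; lra.
  rewrite (_ : 8 = 2 ^+ 3 :> R); last by lra.
  rewrite -invfM -exprS ler_pdivlMl ?exprn_gt0 // -!exprD ler_eXn2l ?ltr1n //; lia.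
rewrite [leRHS](_ : _ = 2^-1 * 2 ^- k + 2^-1 * 2 ^- k); last by lra.
exact: lerD.
Qed.

Lemma density_computable (c : R) : (forall T s n, (1 < T)%N -> 0 <= s < 1 -> (0 < n)%N ->
    `|(C n)%:R / n%:R - c| <= density_err T s n) -> computable_real c.
Proof.
move=> Hc; have r2 : recn (fun _ : 1.-tuple nat => 2) by exact: recn_const.
have rN : recn (fun v : 1.-tuple nat => 2 ^ (2 ^ (thead v + 8)))%N.
  by apply: recn_exp r2 (recn_exp r2 (recn_add (recn_head _) (recn_const _ 8))).
exists (fun=> 0%N), (fun k => C (2 ^ (2 ^ (k + 8)))), (fun k => 2 ^ (2 ^ (k + 8)))%N; split.
- by apply: recn_recursive; exact: recn_const.
- by apply: (@recn_recursive (fun k => C (2 ^ (2 ^ (k + 8))))); exact: recn_C rN.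
- exact: (@recn_recursive (fun k => 2 ^ (2 ^ (k + 8)))%N) rN.
- by move=> k; rewrite -lt0n expn_gt0.
move=> k; rewrite expr0 mul1r distrC; apply: le_trans (Hc (2 ^ (k + 2))%N 2^-1 _ _ _ _) _.
- by rewrite -[1%N]/(2 ^ 0)%N ltn_exp2l // addn_gt0 orbT.
- by apply/andP; split; lra.
- by rewrite expn_gt0.
exact: density_err_dyadic.
Qed.

End Computability.

Lemma error_bigO (R : realType) (c eps : R) (E : nat -> R) : 0 < c -> 0 < eps ->
  (forall T s n, (1 < T)%N -> 0 <= s < 1 -> (0 < n)%N ->
    `|(C n)%:R / n%:R - c| <= density_err T s n) ->
  (forall n, (0 < n)%N -> `|E n| = `|(C n)%:R / n%:R - c| / c) ->
  E =O_\oo (fun n : nat => expR (- Num.sqrt ((6^-1 - eps) * ln n%:R * ln (ln n%:R)))).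
Proof.
move=> c0 eps0 Hc HE; apply/eqO_exP; exists (8 / c); first by rewrite divr_gt0.
near=> n.
have nbig : expR (expR (400 ^+ 4)) <= n%:R :> R by near: n; exact: nbhs_infty_ger.
have nR : 0 < n%:R :> R by apply: lt_le_trans nbig; exact: expR_gt0.
have n0 : (0 < n)%N by rewrite -(ltr_nat R).
have ln1 : expR (400 ^+ 4) <= ln n%:R :> R by rewrite -[leLHS]expRK ler_ln ?posrE ?expR_gt0.
have X0 : 0 < ln n%:R :> R by apply: lt_le_trans ln1; exact: expR_gt0.
have ln2 : 400 ^+ 4 <= ln (ln n%:R) :> R by rewrite -[leLHS]expRK ler_ln ?posrE ?expR_gt0.
have l0 : 0 <= ln (ln n%:R) :> R by apply: le_trans ln2; rewrite exprn_ge0.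
have [T [s [T1 s1 err]]] := density_err_le ln2 n0.
rewrite HE // [X in _ <= _ * X]ger0_norm ?expR_ge0 // [leRHS]mulrAC.
apply: ler_wpM2r; first by rewrite invr_ge0 ltW.
apply: le_trans (Hc T s n T1 s1 n0) _; apply: le_trans err _.
rewrite ler_wpM2l // ler_expR lerN2.
move: X0 l0; set X := ln n%:R; set l := ln X => X0 l0.
(* [(9 / 20) ^ 2 = 81 / 400] exceeds [1 / 6]. A negative radicand, possible for large [eps], is
   harmless since [Num.sqrt] is monotone and 0 there. *)
rewrite -(@ger0_norm _ (9 / 20)) // -sqrtr_sqr -sqrtrM ?sqr_ge0 //.
apply: ler_wsqrtr; rewrite -mulrA; apply: ler_wpM2r; last by lra.
by rewrite mulr_ge0 // ltW.
Unshelve. all: by end_near.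
Qed.

Theorem theorem2p9 (R : realType) :
  exists c : R,
    [/\ computable_real c,
        (176 * 10 ^+ 3 + 488) / 10 ^+ 6 < c (* 0.176488 < c *)
      & forall eps : R, 0 < eps ->
          exists E : nat -> R,
            E =O_\oo (fun n : nat =>
              expR (- Num.sqrt ((6^-1 - eps) * ln n%:R * ln (ln n%:R)))) /\
            forall n : nat, (0 < n)%N ->
              (C n)%:R = c * n%:R * (1 + E n)].
Proof.
have [c Hc] := density_exists R; exists c.
have clb := density_lb Hc.
have c0 : 0 < c by apply: lt_trans clb; lra.
split; [exact: density_computable|exact: clb|move=> eps eps0].
exists (fun n => (C n)%:R / n%:R / c - 1); split.
  apply: (error_bigO c0 eps0 Hc) => n n0.
  by rewrite -[X in _ = _ / X](gtr0_norm c0) -normf_div mulrBl divff // gt_eqF.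
move=> n n0; have nR : 0 < n%:R :> R by rewrite ltr0n.
by field; rewrite !gt_eqF.
Qed.
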